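(* Let $\Gamma$ be a SODE on a smooth manifold $Q$ and let $q_0\in Q$. Then there exist a (sufficiently small) number $h_0>0$, an open subset $\mathcal U\subseteq D^{\Gamma}_{h_0}\subseteq TQ$, and open subsets $U,\tilde U$ of $Q$ with $q_0\in U\subseteq\tilde U$, such that: (1) the map $exp^{\Gamma}_{h_0}:\mathcal U\subseteq D^\Gamma_{h_0}\to U\times U\subseteq Q\times Q$ is a diffeomorphism; (2) for every couple $(q,q')\in U\times U$ there exists a unique trajectory of $\Gamma$, $\sigma_{qq'}:[0,h_0]\to Q$, contained in $\tilde U$ and satisfying $\sigma_{qq'}(0)=q$, $\sigma_{qq'}(h_0)=q'$ and $\dot\sigma_{qq'}(0)\in\mathcal U$. In particular $\dot\sigma_{q_0q_0}(0)\in\mathcal U$, where $\sigma_{q_0q_0}$ is the trajectory joining $q_0$ to itself in time $h_0$.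
   Context: All objects are smooth. $\tau_Q:TQ\to Q$ is the tangent bundle projection. A SODE on $Q$ is a vector field $\Gamma$ on $TQ$ with $T\tau_Q(\Gamma(v))=v$ for all $v\in TQ$; in natural coordinates $(x^i,\dot x^i)$, $\Gamma=\dot x^i\,\partial/\partial x^i+\Gamma^i(x,\dot x)\,\partial/\partial\dot x^i$. A trajectory of $\Gamma$ is a curve $\sigma$ in $Q$ whose velocity curve $\dot\sigma$ in $TQ$ is an integral curve of $\Gamma$, i.e. locally $\ddot x^i=\Gamma^i(x,\dot x)$. Let $\Phi^\Gamma$ be the (local) flow of $\Gamma$ and $D^\Gamma=\{(t,v)\in\mathbb R\times TQ : \Phi^\Gamma(\cdot,v)\text{ is defined at least on }[0,t]\}$. For $h_0\ge 0$ put $D^\Gamma_{h_0}=\{v\in TQ:(h_0,v)\in D^\Gamma\}$ and define $exp^\Gamma_{h_0}:D^\Gamma_{h_0}\to Q\times Q$ by $exp^\Gamma_{h_0}(v)=(\tau_Q(v),\ \tau_Q(\Phi^\Gamma(h_0,v)))$. *)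

(* Defs.v *)
From HB Require Import structures.
From mathcomp Require Import all_boot all_order all_algebra.
From mathcomp Require Import all_classical all_reals all_analysis.

Set Implicit Arguments.
Unset Strict Implicit.
Unset Printing Implicit Defensive.

Import Order.TTheory GRing.Theory Num.Theory.
Import numFieldNormedType.Exports.

Local Open Scope classical_set_scope.
Local Open Scope ring_scope.

(* f is of class C^k on O; meant for open O and finite-dimensional V.  (In
   finite dimension f is C^k.+1 iff it is differentiable and all the maps
   x |-> df_x(v) are C^k.) *)
Fixpoint class_C (R : realType) (V W : normedModType R) (k : nat)
    (O : set V) (f : V -> W) : Prop :=
  if k is k'.+1 then
    (forall x, O x -> differentiable f x) /\
    (forall v : V, class_C k' O (fun x => 'd f x v))
  else forall x, O x -> {for x, continuous f}.

Definition smooth_on (R : realType) (V W : normedModType R)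
    (O : set V) (f : V -> W) : Prop := forall k, class_C k O f.

(* Manifolds are sets with a smooth atlas, which determines the topology.
   The record holds only the data; the axioms are in smooth_manifold.
   The chart a is given by the bijection coords a from dom a onto an open
   subset of R^n, with inverse param a; the values of coords a and param a
   outside of these sets are irrelevant.  chart_at q is a chosen chart
   around q. *)
Record atlas (R : realType) := Atlas {
  carrier :> Type ;
  dimension : nat ;
  chart : Type ;
  dom : chart -> set carrier ;
  coords : chart -> carrier -> 'rV[R]_dimension ;
  param : chart -> 'rV[R]_dimension -> carrier ;
  chart_at : carrier -> chart }.

Arguments dom {R a} _ _.
Arguments coords {R a} _ _.
Arguments param {R a} _ _.
Arguments chart_at {R a} _.

HB.instance Definition _ (R : realType) (M : atlas R) :=
  gen_eqMixin (carrier M).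
HB.instance Definition _ (R : realType) (M : atlas R) :=
  gen_choiceMixin (carrier M).

Definition chart_subbase (R : realType) (M : atlas R) : set (set M) :=
  [set W | exists (a : chart M) (O : set 'rV[R]_(dimension M)),
             open O /\ W = dom a `&` coords a @^-1` O].

HB.instance Definition _ (R : realType) (M : atlas R) :=
  isSubBaseTopological.Build (carrier M) (@chart_subbase R M) id.

Record smooth_manifold (R : realType) (M : atlas R) : Prop := SmoothManifold {
  chart_atP : forall q : M, dom (chart_at q) q ;
  coordK : forall (a : chart M) (q : M), dom a q -> param a (coords a q) = q ;
  overlap_open : forall a b : chart M, open (coords a @` (dom a `&` dom b)) ;
  overlap_smooth : forall a b : chart M,
    smooth_on (coords a @` (dom a `&` dom b)) (coords b \o param a) ;
  manifold_hausdorff : hausdorff_space M ;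
  manifold_second_countable : @second_countable M }.

Definition product (R : realType) (M N : atlas R) : atlas R := {|
  carrier := (M * N)%type ;
  dimension := (dimension M + dimension N)%N ;
  chart := (chart M * chart N)%type ;
  dom := fun a => dom a.1 `*` dom a.2 ;
  coords := fun a p => row_mx (coords a.1 p.1) (coords a.2 p.2) ;
  param := fun a y => (param a.1 (lsubmx y), param a.2 (rsubmx y)) ;
  chart_at := fun p => (chart_at p.1, chart_at p.2) |}.

(* The tangent bundle TM.  The pair (q, v) stands for the tangent vector at q
   whose components in the chosen chart chart_at q are v; its components in any
   other chart a around q are obtained by the Jacobian of the change of
   coordinates.  The chart of TM induced by a is the natural one (x, xdot). *)
Definition tangent (R : realType) (M : atlas R) : atlas R := {|
  carrier := (M * 'rV[R]_(dimension M))%type ;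
  dimension := (dimension M + dimension M)%N ;
  chart := chart M ;
  dom := fun a => [set w | dom a w.1] ;
  coords := fun a w =>
    let c := chart_at w.1 in
    row_mx (coords a w.1) ('d (coords a \o param c) (coords c w.1) w.2) ;
  param := fun a y =>
    let q := param a (lsubmx y) in
    (q, 'd (coords (chart_at q) \o param a) (lsubmx y) (rsubmx y)) ;
  chart_at := fun w => chart_at w.1 |}.

Definition tau (R : realType) (M : atlas R) (w : tangent M) : M := w.1.

(* smoothness on W, meant for open W, of a map between manifolds *)
Definition smooth_map (R : realType) (M N : atlas R) (W : set M) (f : M -> N)
    : Prop :=
  (forall p, W p -> {for p, continuous f}) /\
  forall (a : chart M) (b : chart N),
    smooth_on (coords a @` (W `&` dom a `&` f @^-1` dom b))
              (coords b \o f \o param a).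

Definition diffeomorphism (R : realType) (M N : atlas R)
    (W : set M) (V : set N) (f : M -> N) : Prop :=
  smooth_map W f /\
  exists g : N -> M,
    [/\ smooth_map V g,
        (forall p, W p -> V (f p) /\ g (f p) = p) &
        (forall r, V r -> W (g r) /\ f (g r) = r)].

Definition tangent_map (R : realType) (M N : atlas R) (f : M -> N)
    (w : tangent M) : tangent N :=
  let a := chart_at w.1 in
  (f w.1, 'd (coords (chart_at (f w.1)) \o f \o param a) (coords a w.1) w.2).

Definition vector_field (R : realType) (M : atlas R) (X : M -> tangent M)
    : Prop :=
  smooth_map setT X /\ forall p, tau (X p) = p.

Definition sode (R : realType) (Q : atlas R)
    (Gamma : tangent Q -> tangent (tangent Q)) : Prop :=
  vector_field Gamma /\
  forall v : tangent Q, tangent_map (@tau R Q) (Gamma v) = v.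

(* A curve on an interval J, possibly closed, is smooth when it extends to a
   smooth curve on an open set; values outside of J are irrelevant. *)
Definition smooth_curve (R : realType) (M : atlas R) (J : set R) (c : R -> M)
    : Prop :=
  exists (W : set R) (c' : R -> M),
    [/\ open W, J `<=` W, (forall t, J t -> c' t = c t),
        (forall t, W t -> {for t, continuous c'}) &
        forall a : chart M,
          smooth_on (W `&` c' @^-1` dom a) (coords a \o c')].

(* The derivative is taken within J, thus one-sided at an endpoint of J. *)
Definition velocity (R : realType) (M : atlas R) (J : set R) (c : R -> M)
    (t : R) : tangent M :=
  let x := coords (chart_at (c t)) in
  (c t, lim ((s - t)^-1 *: (x (c s) - x (c t)) @[s --> within J t^'])).

Definition integral_curve (R : realType) (M : atlas R) (X : M -> tangent M)
    (J : set R) (c : R -> M) : Prop :=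
  smooth_curve J c /\ forall t, J t -> velocity J c t = X (c t).

Definition trajectory (R : realType) (Q : atlas R)
    (Gamma : tangent Q -> tangent (tangent Q)) (J : set R) (sigma : R -> Q)
    : Prop :=
  smooth_curve J sigma /\ integral_curve Gamma J (velocity J sigma).

(* The maximal integral curve of X from v is defined at t, with value w.  On a
   Hausdorff manifold w is unique. *)
Definition flows_to (R : realType) (M : atlas R) (X : M -> tangent M)
    (t : R) (v w : M) : Prop :=
  exists (J : set R) (c : R -> M),
    [/\ open J, is_interval J, J 0 & J t] /\
    [/\ integral_curve X J c, c 0 = v & c t = w].

Definition flow (R : realType) (M : atlas R) (X : M -> tangent M)
    (t : R) (v : M) : M := xget v (flows_to X t v).

(* As the interval J in flows_to contains 0 and t, it contains [0, t]. *)
Definition flow_domain (R : realType) (M : atlas R) (X : M -> tangent M)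
    : set (R * M) := [set tv | exists w, flows_to X tv.1 tv.2 w].

Definition exp_domain (R : realType) (Q : atlas R)
    (Gamma : tangent Q -> tangent (tangent Q)) (h : R) : set (tangent Q) :=
  [set v | flow_domain Gamma (h, v)].

Definition exp_map (R : realType) (Q : atlas R)
    (Gamma : tangent Q -> tangent (tangent Q)) (h : R) (v : tangent Q)
    : product Q Q :=
  (tau v, tau (flow Gamma h v)).

(* Main.v *)
From HB Require Import structures.
Require Import Defs.
From mathcomp Require Import all_boot all_order all_algebra.
From mathcomp Require Import all_classical all_reals all_analysis.
From mathcomp Require Import ring lra.
From mathcomp Require finmap.

(** Read in a chart around q0, the field is a second-order equation, and in a short
   time h a solution from (x, v) arrives at x + h v plus an error. The error is
   of order h^2 in size, and its Lipschitz constant in the initial state is a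
   small multiple of h, because it results from integrating twice over [0, h] a
   force that is Lipschitz on a fixed ball. As the force may grow arbitrarily
   fast with the velocity, v is confined to a fixed ball, and so the endpoints
   to a ball around x0 whose radius is a multiple of h. Two things follow
   (local_exponential). For fixed x, hitting x' means solving a fixed
   point equation for v with a contraction, so every pair (x, x') near (x0, x0)
   is joined. And the map from (x, v) to the pair of endpoints expands distances
   by a multiple of h, so the velocity is unique and the inverse is Lipschitz.

   That the endpoint is a smooth function of (x, v) is the smooth dependence of
   solutions on initial values. It is obtained from first-order dependence
   (solution_differentiable, by Gronwall's inequality) applied to the equation
   coupled with its linearisation, by induction on the class
   (solution_class_C). The inverse is then smooth because an expanding map has
   invertible differentials (inverse_smooth). Solutions come from Picard
   iteration, applied to a globally Lipschitz field that agrees with the given one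
   on a box (global_solution, local_flow).

   On the manifold, the components of the field in a chart have the second-order
   form in every chart (sode_coords), smoothness has to be tested in a single
   pair of charts only (smooth_map_of_chart), and an integral curve that starts
   on a chart solution coincides with it for the whole time [0, h]
   (integral_curve_unique). The last fact identifies the flow, which is defined
   by integral curves anywhere in the tangent bundle, with the solution in the
   chart, and it also gives the uniqueness of the joining trajectory. *)

Import Order.TTheory GRing.Theory Num.Theory.
Import numFieldNormedType.Exports.
Local Open Scope classical_set_scope.
Local Open Scope ring_scope.
Set Implicit Arguments.
Unset Strict Implicit.
Unset Printing Implicit Defensive.

(** * Row vectors *)

Section RowVectors.
Context {R : realType}.

Lemma row_norm_le n (x : 'rV[R]_n) (c : R) : 0 <= c ->
  (forall i, `|x 0 i| <= c) -> `|x| <= c.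
Proof.
move=> c0 xc; rewrite [`|x|]/Num.norm /= mx_normrE bigmax_le // => -[i j] _ /=.
by rewrite (ord1 i).
Qed.

Lemma row_coord_le n (x : 'rV[R]_n) i : `|x 0 i| <= `|x|.
Proof.
rewrite [leRHS]/Num.norm /= mx_normrE.
exact: (le_bigmax 0 (fun k : 'I_1 * 'I_n => `|x k.1 k.2|) (0, i)).
Qed.

Lemma row_mx_norm_le n m (x : 'rV[R]_n) (y : 'rV[R]_m) (c : R) :
  `|x| <= c -> `|y| <= c -> `|row_mx x y| <= c.
Proof.
move=> xc yc; apply: row_norm_le => [|i]; first exact: le_trans (normr_ge0 x) xc.
case: (split_ordP i) => j ->; rewrite ?row_mxEl ?row_mxEr.
  exact: le_trans (row_coord_le x j) xc.
exact: le_trans (row_coord_le y j) yc.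
Qed.

Lemma lsubmx_norm n m (z : 'rV[R]_(n + m)) : `|lsubmx z| <= `|z|.
Proof. by apply: row_norm_le => // i; rewrite mxE row_coord_le. Qed.

Lemma rsubmx_norm n m (z : 'rV[R]_(n + m)) : `|rsubmx z| <= `|z|.
Proof. by apply: row_norm_le => // i; rewrite mxE row_coord_le. Qed.

Lemma row_continuous (T : topologicalType) n (f : T -> 'rV[R]_n) (x : T) :
  (forall i, {for x, continuous (fun y => f y 0 i)}) -> {for x, continuous f}.
Proof.
move=> fc; apply/cvgrPdist_le => e e0; near=> y.
apply: row_norm_le (ltW e0) _ => i; rewrite !mxE.
move: i; near: y; apply: filter_forall => i.
exact: (cvgrPdist_le _ _).1 (fc i) e e0.
Unshelve. all: by end_near. Qed.

Lemma row_linear_continuous (W : normedModType R) n (f : {linear 'rV[R]_n -> W}) :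
  continuous f.
Proof.
move=> x; have -> : (f : _ -> _) = \sum_(i < n) (fun y : 'rV[R]_n => y 0 i *: f 'e_i).
  apply/funext => y; rewrite {1}(row_sum_delta y) raddf_sum fct_sumE.
  by apply: eq_bigr => i _; exact: linearZZ.
apply: differentiable_continuous; apply: differentiable_sum => i.
exact/differentiableZl/differentiable_coord.
Qed.

End RowVectors.

(** * Differentials *)

Section Differentials.
Context {R : realType} {V W : normedModType R}.

(** Estimates on solutions come as epsilon bounds on increments; this turns such
   a bound into the value of the differential. *)
Lemma diff_eps (f : V -> W) (df : {linear V -> W}) x : continuous df ->
  (forall e, 0 < e -> \forall h \near 0, `|f (x + h) - f x - df h| <= e * `|h|) ->
  differentiable f x /\ 'd f x = df :> (V -> W).
Proof.
move=> dfc fe; have fo : f \o shift x = cst (f x) + df +o_ 0 id.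
  apply/eqaddoP => e e0; near=> h; rewrite !fctE /= opprD addrA addrC [h + x]addrC.
  by rewrite addrC; near: h; exact: fe.
have E := diff_unique dfc fo; split => //.
by apply/diff_locallyP; rewrite E.
Unshelve. all: by end_near. Qed.

Lemma diff_epsP (f : V -> W) x : differentiable f x ->
  forall e, 0 < e -> \forall h \near 0, `|f (x + h) - f x - 'd f x h| <= e * `|h|.
Proof.
move=> /diff_locally/eqaddoP fe e e0; near=> h.
have : `|(f \o shift x - (cst (f x) + 'd f x : _ -> _)) h| <= e * `|h|.
  by near: h; exact: fe.
by rewrite !fctE /= opprD addrA [h + x]addrC.
Unshelve. all: by end_near. Qed.

Lemma nbhs0_addl (O : set V) (x : V) : nbhs x O -> \forall h \near 0, O (x + h).
Proof.
move=> xO; have : nbhs (x + 0) O by rewrite addr0.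
by move=> /(cvgD (cvg_cst x) (@cvg_id _ (nbhs (0 : V)))).
Qed.

Lemma diff_near (f g : V -> W) x : (\near x, f x = g x) -> differentiable f x ->
  differentiable g x /\ 'd g x = 'd f x :> (V -> W).
Proof.
move=> fg df; apply: diff_eps => [|e e0]; first exact: diff_continuous.
have fgx := nbhs_singleton fg; near=> h; rewrite -fgx.
suff <- : f (x + h) = g (x + h) by near: h; exact: diff_epsP.
near: h; move: fg => /nbhs_ballP[r r0 fg].
apply/nbhs_ballP; exists r => // h; rewrite -!ball_normE /= sub0r => hr.
by apply: fg; rewrite -ball_normE /= opprD addrA subrr sub0r.
Unshelve. all: by end_near. Qed.

Lemma diff_ext (O : set V) (f g : V -> W) x : open O -> {in O, f =1 g} -> O x ->
  differentiable f x -> differentiable g x /\ 'd g x = 'd f x :> (V -> W).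
Proof.
move=> oO fg Ox; apply: diff_near.
near=> y; apply: fg; rewrite inE; near: y; exact: open_nbhs_nbhs.
Unshelve. all: by end_near. Qed.

End Differentials.

Section DifferentialRow.
Context {R : realType} {V : normedModType R}.

Lemma diff_row n (f : V -> 'rV[R]_n) x :
  (forall i, differentiable (fun y => f y 0 i) x) <-> differentiable f x.
Proof.
split=> [fi|df i].
  have -> : f = \sum_(i < n) (fun y => f y 0 i *: 'e_i).
    by apply/funext => y; rewrite {1}(row_sum_delta (f y)) fct_sumE.
  by apply: differentiable_sum => i; exact: differentiableZl.
exact: (differentiable_comp df (differentiable_coord _ _ _)).
Qed.

Lemma diff_rowE n (f : V -> 'rV[R]_n) x v i : differentiable f x ->
  'd (fun y => f y 0 i) x v = 'd f x v 0 i.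
Proof.
move=> df; pose c (M : 'rV[R]_n) : R := M 0 i.
have cl : linear c by move=> a u w; rewrite /c !mxE.
pose cL : {linear _ -> _} := HB.pack c (GRing.isLinear.Build _ _ _ _ _ cl).
have cc : continuous cL by exact: coord_continuous.
rewrite -[LHS]/('d (cL \o f) x v) diff_comp //; last exact: differentiable_coord.
by rewrite diff_lin.
Qed.

Lemma linear_rowE (W : normedModType R) n (f : {linear 'rV[R]_n -> W}) v :
  f v = \sum_i v 0 i *: f 'e_i.
Proof.
by rewrite {1}(row_sum_delta v) raddf_sum; apply: eq_bigr => i _; exact: linearZZ.
Qed.

End DifferentialRow.

(** * Functions of class C^k *)

Section ClassC.
Context {R : realType}.
Implicit Types V W : normedModType R.

Lemma class_C_ext V W k (O : set V) (f g : V -> W) : open O -> {in O, f =1 g} ->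
  class_C k O f -> class_C k O g.
Proof.
move=> oO; elim: k f g => [|k IH] f g fg /=.
  move=> fc x Ox; have := fc x Ox; rewrite /prop_for /continuous_at -fg ?inE //.
  move=> H; apply: cvg_trans H; apply: near_eq_cvg; near=> y.
  apply: fg; rewrite inE; near: y; exact: open_nbhs_nbhs.
move=> [df Cf]; split=> [x Ox|v].
  by have [] := diff_ext oO fg Ox (df x Ox).
apply: (IH (fun x => 'd f x v)) => // x; rewrite inE => Ox.
by have [_ ->] := diff_ext oO fg Ox (df x Ox).
Unshelve. all: by end_near. Qed.

(** Every clause in the definition of the class concerns one point at a time. *)
Lemma class_C_local V W k (O : set V) (f : V -> W) :
  (forall x, O x -> exists2 B, B x & class_C k B f) -> class_C k O f.
Proof.
elim: k f => [|k IH] f /= locf; first by move=> x /locf [B Bx Cx]; exact: Cx.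
split=> [x /locf [B Bx []] df _|v]; first exact: df.
by apply: IH => x /locf [B Bx [_ Cf]]; exists B.
Qed.

Lemma class_C_subset V W k (O B : set V) (f : V -> W) : B `<=` O ->
  class_C k O f -> class_C k B f.
Proof. by move=> OO' Cf; apply: class_C_local => x /OO' Ox; exists O. Qed.

Lemma class_CS V W k (O : set V) (f : V -> W) : class_C k.+1 O f -> class_C k O f.
Proof.
elim: k f => [|k IH] f; first by move=> [df _] x Ox; exact/differentiable_continuous/df.
by move=> [df Cf]; split => // v; exact: IH.
Qed.

Lemma class_C_cst V W k (O : set V) (a : W) : class_C k O (cst a).
Proof.
elim: k a => [|k IH] a /=; first by move=> x _; exact: cst_continuous.
split=> [x _|v]; first exact: differentiable_cst.
have -> : (fun x => 'd (cst a) x v) = cst (0 : W) by apply/funext => x; rewrite diff_cst.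
exact: IH.
Qed.

Lemma class_C_linear V W k (O : set V) (f : {linear V -> W}) : continuous f ->
  class_C k O f.
Proof.
move=> fc; case: k => [|k]; first by move=> x _; exact: fc.
split=> [x _|v]; first exact: linear_differentiable.
have -> : (fun x => 'd f x v) = cst (f v) by apply/funext => x; rewrite diff_lin.
exact: class_C_cst.
Qed.

Lemma class_C_row V n k (O : set V) (f : V -> 'rV[R]_n) : open O ->
  (forall i, class_C k O (fun x => f x 0 i)) <-> class_C k O f.
Proof.
move=> oO; elim: k f => [|k IH] f.
  split=> [fi x Ox|fc i x Ox]; first by apply: row_continuous => i; exact: fi.
  exact: (continuous_comp (fc x Ox) (@coord_continuous _ _ _ _ _ _)).
split=> [Cf|[df Cf] i].
  have df x : O x -> differentiable f x by move=> Ox; apply/diff_row => i; exact: (Cf i).1.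
  split=> // v; apply/IH => i; apply: class_C_ext oO _ ((Cf i).2 v) => x; rewrite inE => Ox.
  by rewrite diff_rowE //; exact: df.
split=> [x Ox|v]; first by move/diff_row: (df x Ox).
apply: class_C_ext oO _ ((IH _).2 (Cf v) i) => x; rewrite inE => Ox.
by rewrite diff_rowE //; exact: df.
Qed.

Lemma class_CD V W k (O : set V) (f g : V -> W) : open O ->
  class_C k O f -> class_C k O g -> class_C k O (fun x => f x + g x).
Proof.
move=> oO; elim: k f g => [|k IH] f g.
  by move=> fc gc x Ox; apply: continuousD; [exact: fc|exact: gc].
move=> [df Cf] [dg Cg]; split=> [x Ox|v].
  exact: differentiableD (df x Ox) (dg x Ox).
apply: class_C_ext oO _ (IH _ _ (Cf v) (Cg v)) => x; rewrite inE => Ox.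
by rewrite -[in RHS]/('d (f + g) x v) diffD //; [exact: df|exact: dg].
Qed.

Lemma class_CM V k (O : set V) (f g : V -> R) : open O ->
  class_C k O f -> class_C k O g -> class_C k O (fun x => f x * g x).
Proof.
move=> oO; elim: k f g => [|k IH] f g.
  by move=> fc gc x Ox; apply: continuousM; [exact: fc|exact: gc].
move=> /[dup] /class_CS Cf0 [df Cf] /[dup] /class_CS Cg0 [dg Cg]; split=> [x Ox|v].
  exact: differentiableM (df x Ox) (dg x Ox).
apply: class_C_ext oO _ (class_CD oO (IH _ _ Cf0 (Cg v)) (IH _ _ Cg0 (Cf v))) => x; rewrite inE => Ox.
by rewrite -[in RHS]/('d (f * g) x v) diffM //; [exact: df|exact: dg].
Qed.

Lemma class_C_sum V W k (O : set V) (I : Type) (r : seq I) (P : pred I) (f : I -> V -> W) :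
  open O -> (forall i, P i -> class_C k O (f i)) -> class_C k O (fun x => \sum_(i <- r | P i) f i x).
Proof.
move=> oO Cf; elim: r => [|i r IH].
  have -> : (fun x => \sum_(i <- [::] | P i) f i x) = cst 0 by apply/funext => x; rewrite big_nil.
  exact: class_C_cst.
have [Pi|Pi] := boolP (P i); last first.
  by apply: class_C_ext oO _ IH => x _; rewrite big_cons (negPf Pi).
by apply: class_C_ext oO _ (class_CD oO (Cf i Pi) IH) => x _; rewrite big_cons Pi.
Qed.

Lemma class_C_prod V k (O : set V) (I : Type) (r : seq I) (f : I -> V -> R) :
  open O -> (forall i, class_C k O (f i)) -> class_C k O (fun x => \prod_(i <- r) f i x).
Proof.
move=> oO Cf; elim: r => [|i r IH].
  have -> : (fun x => \prod_(i <- [::]) f i x) = cst 1 by apply/funext => x; rewrite big_nil.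
  exact: class_C_cst.
by apply: class_C_ext oO _ (class_CM oO (Cf i) IH) => x _; rewrite big_cons.
Qed.

Lemma class_CV V k (O : set V) (f : V -> R) : open O -> (forall x, O x -> f x != 0) ->
  class_C k O f -> class_C k O (fun x => (f x)^-1).
Proof.
move=> oO f0; elim: k => [|k IH].
  by move=> fc x Ox; apply: continuousV; [exact: f0|exact: fc].
move=> /[dup] /class_CS Cf0 [df Cf]; split=> [x Ox|v].
  exact: differentiableV (df x Ox) (f0 x Ox).
have C1 := class_CM oO (IH Cf0) (IH Cf0).
have C2 := class_CM oO (class_C_cst k O (-1 : R)) (class_CM oO C1 (Cf v)).
apply: class_C_ext oO _ C2 => x; rewrite inE => Ox.
rewrite diffV //=; [|exact: df|exact: f0].
by rewrite expr2 invfM mulN1r -mulNr.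
Qed.

(** The chain rule expresses the differential of a composite through partial
   derivatives, hence through sums and products of functions that are one class
   lower; finite dimension of the middle space is what makes this a finite sum. *)
Lemma class_C_comp V n k (O : set V) (B : set 'rV[R]_n) (f : V -> 'rV[R]_n) (g : 'rV[R]_n -> R) :
  open O -> (forall x, O x -> B (f x)) ->
  class_C k O f -> class_C k B g -> class_C k O (g \o f).
Proof.
move=> oO OO'; elim: k f g OO' => [|k IH] f g OO'.
  by move=> fc gc x Ox; apply: continuous_comp; [exact: fc|exact/gc/OO'].
move=> /[dup] /class_CS Cf0 [df Cf] [dg Cg].
split=> [x Ox|v]; first by apply: differentiable_comp; [exact: df|exact/dg/OO'].
have C1 : class_C k O (fun x => \sum_i 'd f x v 0 i * 'd g (f x) 'e_i).
  apply: class_C_sum => // i _; apply: class_CM => //.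
    exact: (class_C_row _ _ oO).2 (Cf v) i.
  exact: IH OO' Cf0 (Cg 'e_i).
apply: class_C_ext oO _ C1 => x; rewrite inE => Ox.
have dfx := df x Ox; have dgx := dg _ (OO' x Ox).
rewrite (diff_comp dfx dgx) /=.
by rewrite [RHS]linear_rowE.
Qed.

Lemma class_C_comp_row V n m k (O : set V) (B : set 'rV[R]_n) (f : V -> 'rV[R]_n)
  (g : 'rV[R]_n -> 'rV[R]_m) : open O -> open B -> (forall x, O x -> B (f x)) ->
  class_C k O f -> class_C k B g -> class_C k O (g \o f).
Proof.
move=> oO oO' OO' Cf Cg; apply/class_C_row => // i.
exact: class_C_comp oO OO' Cf ((class_C_row _ _ oO').2 Cg i).
Qed.

Lemma class_C_row_mx V n m k (O : set V) (f : V -> 'rV[R]_n) (g : V -> 'rV[R]_m) :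
  open O -> class_C k O f -> class_C k O g -> class_C k O (fun x => row_mx (f x) (g x)).
Proof.
move=> oO Cf Cg; apply/class_C_row => // i; case: (split_ordP i) => j ->.
  by apply: class_C_ext oO _ ((class_C_row _ _ oO).2 Cf j) => x _; rewrite row_mxEl.
by apply: class_C_ext oO _ ((class_C_row _ _ oO).2 Cg j) => x _; rewrite row_mxEr.
Qed.

Lemma class_C_lsubmx k n m (O : set 'rV[R]_(n + m)) : class_C k O (lsubmx : _ -> 'rV[R]_n).
Proof. exact: (@class_C_linear _ _ _ _ lsubmx) (@continuous_lsubmx _ _ _ _). Qed.

Lemma class_C_rsubmx k n m (O : set 'rV[R]_(n + m)) : class_C k O (rsubmx : _ -> 'rV[R]_m).
Proof. exact: (@class_C_linear _ _ _ _ rsubmx) (@continuous_rsubmx _ _ _ _). Qed.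

(** Linearised equations and changes of coordinates on a tangent bundle apply a
   differential to a vector that varies together with the base point. *)
Lemma class_C_diff V n m k (O : set V) (B : set 'rV[R]_n) (x : V -> 'rV[R]_n) (v : V -> 'rV[R]_n)
  (f : 'rV[R]_n -> 'rV[R]_m) : open O -> open B -> (forall p, O p -> B (x p)) ->
  class_C k O x -> class_C k O v -> class_C k.+1 B f -> class_C k O (fun p => 'd f (x p) (v p)).
Proof.
move=> oO oO' OO' Cx Cv [df Cf].
apply/class_C_row => // j.
have C1 : class_C k O (fun p => \sum_i v p 0 i * 'd f (x p) 'e_i 0 j).
  apply: class_C_sum => // i _; apply: class_CM => //.
    exact: (class_C_row _ _ oO).2 Cv i.
  exact: (class_C_comp oO OO' Cx ((class_C_row _ _ oO').2 (Cf 'e_i) j)).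
apply: class_C_ext oO _ C1 => p _.
by rewrite [in RHS]linear_rowE summxE; apply: eq_bigr => i _; rewrite mxE.
Qed.

End ClassC.

(** * Mean value bounds and Gronwall's inequality *)

Section Curves.
Context {R : realType}.
Implicit Types V W : normedModType R.

Lemma is_derive1_diff W (y : R -> W) (t : R) (d : W) :
  is_derive t 1 y d <-> differentiable y t /\ 'd y t 1 = d.
Proof.
split=> [yd|[dy <-]].
  have dy : differentiable y t by apply/derivable1_diffP; exact: ex_derive.
  by split => //; rewrite -deriveE // derive_val.
rewrite -deriveE //; apply/derivableP/derivable1_diffP => //.
Qed.

Lemma is_derive1_comp V W (y : R -> V) (f : V -> W) (t : R) (d : V) : is_derive t 1 y d ->
  differentiable f (y t) -> is_derive t 1 (f \o y) ('d f (y t) d).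
Proof.
move=> /is_derive1_diff[dy <-] df; apply/is_derive1_diff; split.
  exact: differentiable_comp.
by rewrite diff_comp.
Qed.

Lemma is_derive1_row n (y : R -> 'rV[R]_n) (t : R) (d : 'rV[R]_n) :
  is_derive t 1 y d <-> forall i, is_derive t 1 (fun s => y s 0 i) (d 0 i).
Proof.
split=> [/is_derive1_diff[dy <-] i|yi].
  by apply/is_derive1_diff; split; [by move/diff_row : dy|rewrite diff_rowE].
have dy : differentiable y t.
  by apply/diff_row => i; have /is_derive1_diff[] := yi i.
apply/is_derive1_diff; split=> //; apply/rowP => i.
by have /is_derive1_diff[_ <-] := yi i; rewrite diff_rowE.
Qed.

Lemma is_derive1_continuous W (y : R -> W) (t : R) (d : W) : is_derive t 1 y d -> {for t, continuous y}.
Proof. by move=> /is_derive1_diff[dy _]; exact: differentiable_continuous. Qed.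

Lemma is_derive1_scalel W (t : R) (w : W) : is_derive t 1 (fun s => s *: w) w.
Proof.
have E : is_diff t ( *:%R^~ w : R -> W) ( *:%R^~ w) by exact: is_diff_scalel.
by apply/is_derive1_diff; split; [exact: ex_diff|rewrite diff_val scale1r].
Qed.

(** Comparing with a scalar function g, rather than with a constant, is what lets
   exponential weights enter the estimates below. *)
Lemma mean_value_bound n (u u' : R -> 'rV[R]_n) (g g' : R -> R) (a b : R) : a <= b ->
  (forall t : R, a <= t <= b -> is_derive t 1 u (u' t)) ->
  (forall t : R, a <= t <= b -> is_derive t 1 g (g' t)) ->
  (forall t : R, a <= t <= b -> `|u' t| <= g' t) -> `|u b - u a| <= g b - g a.
Proof.
move=> ab du dg ug.
have itvP t : t \in `]a, b[ -> a <= t <= b.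
  by rewrite in_itv /= => /andP[/ltW -> /ltW ->].
have mono (h h' : R -> R) : (forall t : R, a <= t <= b -> is_derive t 1 h (h' t)) ->
    (forall t : R, a <= t <= b -> 0 <= h' t) -> h a <= h b.
  move=> dh h0.
  have hd x : x \in `]a, b[ -> is_derive x 1 h (h' x) by move=> /itvP; exact: dh.
  have [|c cab E] := MVT_segment ab hd.
    apply/continuous_in_subspaceT => x; rewrite inE /= in_itv /= => xab.
    exact: is_derive1_continuous (dh x xab).
  by rewrite -subr_ge0 E mulr_ge0 ?subr_ge0 //; apply: h0; rewrite in_itv in cab.
have g0 : 0 <= g b - g a.
  rewrite subr_ge0; apply: (mono g g') => // t tab.
  exact: le_trans (normr_ge0 _) (ug t tab).
apply: row_norm_le => // i; rewrite !mxE ler_norml; apply/andP; split.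
  suff : g a + u a 0 i <= g b + u b 0 i by lra.
  apply: (mono (fun s => g s + u s 0 i) (fun s => g' s + u' s 0 i)) => t tab.
    by apply: is_deriveD; [exact: dg|have /is_derive1_row := du t tab; apply].
  have := ler_norm (- (u' t 0 i)); have := row_coord_le (u' t) i; have := ug t tab.
  by rewrite normrN; lra.
suff : g a - u a 0 i <= g b - u b 0 i by lra.
apply: (mono (fun s => g s - u s 0 i) (fun s => g' s - u' s 0 i)) => t tab.
  by apply: is_deriveB; [exact: dg|have /is_derive1_row := du t tab; apply].
have := ler_norm (u' t 0 i); have := row_coord_le (u' t) i; have := ug t tab.
by lra.
Qed.

Lemma mean_value_segment V n (f : V -> 'rV[R]_n) x y (M : R) :
  (forall t : R, 0 <= t <= 1 -> differentiable f (x + t *: (y - x))) ->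
  (forall t : R, 0 <= t <= 1 -> `|'d f (x + t *: (y - x)) (y - x)| <= M) ->
  `|f y - f x| <= M.
Proof.
move=> df bf; pose c (t : R) := x + t *: (y - x).
have dc (t : R) : is_derive t 1 c (y - x).
  rewrite -[y - x]add0r; apply: is_deriveD.
  exact: is_derive1_scalel.
have -> : f y = (f \o c) 1 by rewrite /c /= scale1r addrC subrK.
have -> : f x = (f \o c) 0 by rewrite /c /= scale0r addr0.
have -> : M = (fun t => t * M) 1 - (fun t => t * M) 0 by rewrite /= mul1r mul0r subr0.
apply: (@mean_value_bound _ (f \o c) (fun t => 'd f (c t) (y - x)) (fun t => t * M) (fun=> M)) => // t t01.
  by apply: is_derive1_comp => //; exact: df.
exact: (is_derive1_scalel t (M : R)).
Qed.

Lemma mean_value_const n (u u' : R -> 'rV[R]_n) (C a b : R) : a <= b ->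
  (forall t : R, a <= t <= b -> is_derive t 1 u (u' t)) ->
  (forall t : R, a <= t <= b -> `|u' t| <= C) -> `|u b - u a| <= (b - a) * C.
Proof.
move=> ab du bu; rewrite mulrBl.
apply: (@mean_value_bound _ u u' (fun s => s * C) (fun=> C)) => // t _.
exact: (is_derive1_scalel t (C : R)).
Qed.

Definition gronwall_const (L T : R) : R := 2 * expR (2 * (L + 1) * T).

Lemma gronwall_const_ge0 L T : 0 <= gronwall_const L T.
Proof. by rewrite mulr_ge0 // expR_ge0. Qed.

Lemma is_derive_exp (a t : R) : is_derive t 1 (fun s => expR (a * s)) (a * expR (a * t)).
Proof.
have H : is_derive t 1 ( *%R a : R -> R) a.
  have -> : ( *%R a : R -> R) = ( *:%R^~ a) by apply/funext => s /=; rewrite [RHS]mulrC.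
  exact: is_derive1_scalel.
have [dex vex] := (is_derive1_diff _ _ _).1 (is_derive_expR (a * t)).
have := is_derive1_comp H dex.
have lin b : 'd expR (a * t) b = b * 'd expR (a * t) 1.
  by rewrite -[b in LHS]mulr1; exact: linearZZ.
by rewrite lin vex.
Qed.

(** At its maximum on [0, T] the norm of u weighted by exp (- 2 (L + 1) t) is at
   most half of itself plus the data, so that no iteration over small time steps
   is needed. *)
Lemma gronwall n (u u' : R -> 'rV[R]_n) (L T eps : R) : 0 <= L -> 0 <= eps ->
  (forall t : R, 0 <= t <= T -> is_derive t 1 u (u' t)) ->
  (forall t : R, 0 <= t <= T -> `|u' t| <= L * `|u t| + eps) ->
  forall t : R, 0 <= t <= T -> `|u t| <= gronwall_const L T * (`|u 0| + eps).
Proof.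
move=> L0 e0 du bu t tT.
have T0 : 0 <= T by case/andP: tT; exact: le_trans.
pose l := 2 * (L + 1); have l0 : 0 < l by rewrite /l; lra.
pose w s := expR (l * s); have w0 s : 0 < w s by exact: expR_gt0.
pose v s := `|u s| / w s.
have cv : {within `[0, T], continuous v}.
  apply/continuous_in_subspaceT => s; rewrite inE /= in_itv /= => sT.
  apply: (@continuousM _ _ (fun r => `|u r|) (fun r => (w r)^-1)).
    exact: (continuous_comp (is_derive1_continuous (du s sT)) (@norm_continuous _ _ _)).
  apply: continuousV; first by rewrite gt_eqF.
  exact: is_derive1_continuous (is_derive_exp l s).
have [s sT vs] := EVT_max T0 cv.
rewrite in_itv /= in sT.
pose M := v s; have M0 : 0 <= M by rewrite divr_ge0 // ltW.
have bM r : 0 <= r <= T -> `|u r| <= M * w r.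
  by move=> rT; rewrite -ler_pdivrMr //; apply: vs; rewrite in_itv.
have w1 r : 0 <= r -> 1 <= w r.
  by move=> r0; rewrite -expR0 ler_expR mulr_ge0 // ltW.
have key : `|u s - u 0| <= (L * M + eps) / l * w s - (L * M + eps) / l * w 0.
  case/andP: (sT) => s0 sT'.
  apply: (@mean_value_bound _ u u' (fun r => (L * M + eps) / l * w r) (fun r => (L * M + eps) * w r)) => // r /andP[r0 rs].
  - by apply: du; rewrite r0 (le_trans rs).
  - have -> : (L * M + eps) * w r = (L * M + eps) / l * (l * w r).
      by field; rewrite gt_eqF.
    exact: is_deriveZ (is_derive_exp l r).
  - have rT : 0 <= r <= T by rewrite r0 (le_trans rs).
    have := bu r rT; have := ler_wpM2l L0 (bM r rT); have := ler_wpM2l e0 (w1 r r0).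
    by rewrite mulr1 mulrDl; lra.
have key2 : M * w s <= `|u 0| + (L * M + eps) / l * w s.
  have := ler_normB (u s) (u 0); rewrite /M /v divfK ?gt_eqF //.
  have : `|u s| <= `|u s - u 0| + `|u 0|.
    by rewrite -{1}(subrK (u 0) (u s)) ler_normD.
  have : 0 <= (L * M + eps) / l * w 0.
    by rewrite mulr_ge0 // ?(ltW (w0 0)) // divr_ge0 ?(ltW l0) // addr_ge0 // mulr_ge0.
  by move: key; rewrite /M /v; lra.
have key3 : (L * M + eps) / l <= M / 2 + eps / 2.
  rewrite ler_pdivrMr // /l; have : 0 <= L * eps by exact: mulr_ge0.
  by have : 0 <= L * M by [exact: mulr_ge0]; lra.
have key4 : M <= `|u 0| + (M / 2 + eps / 2).
  have ws := w1 s (andP sT).1.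
  have h1 : (L * M + eps) / l * w s <= (M / 2 + eps / 2) * w s.
    by rewrite ler_pM2r.
  have h2 : `|u 0| <= `|u 0| * w s by rewrite ler_peMr.
  rewrite -(ler_pM2r (w0 s)) mulrDl; lra.
apply: le_trans (bM t tT) _.
have wt : w t <= w T by rewrite ler_expR ler_wpM2l // ?(ltW l0) //; case/andP: tT.
rewrite /gronwall_const -/l -/(w T).
apply: (@le_trans _ _ ((2 * (`|u 0| + eps)) * w T)); last by rewrite mulrAC.
by apply: ler_pM => //; [exact: ltW|lra].
Qed.

(** The integrals from - N, normalised to vanish at 0, agree wherever two of them
   are defined, and together they cover the line. *)
Lemma antiderivative (g : R -> R) : continuous g ->
  exists G : R -> R, G 0 = 0 /\ forall t : R, is_derive t 1 G (g t).
Proof.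
move=> cg.
pose F (N : R) x := Rintegral (@lebesgue_measure R) `[- N, x] g.
have dF (N x : R) : - N < x -> is_derive x 1 (F N) (g x).
  move=> Nx; have xx : x < x + 1 by lra.
  have [|dd E] := @continuous_FTC1_closed R g (- N) x _ xx _ Nx (cg x).
    apply: continuous_compact_integrable; first exact: segment_compact.
    exact: continuous_subspaceT.
  by rewrite -E derive1E; exact/derivableP.
pose H N x := F N x - F N 0.
have dH (N x : R) : - N < x -> is_derive x 1 (H N) (g x).
  move=> Nx; rewrite -[g x]subr0; apply: is_deriveB; first exact: dF.
have HE (N N' x : R) : `|x| < N -> `|x| < N' -> H N x = H N' x.
  move=> xN xN'.
  pose u s : 'rV[R]_1 := \row__ (H N s - H N' s).
  have du (s : R) : - N < s -> - N' < s -> is_derive s 1 u (0 : 'rV[R]_1).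
    move=> Ns N's; apply/is_derive1_row => i; rewrite mxE.
    have -> : (fun s0 => u s0 0 i) = H N - H N' by apply/funext => r; rewrite mxE !fctE.
    by rewrite -[0](subrr (g s)); apply: is_deriveB; exact: dH.
  have zero (s : R) : is_derive s 1 (fun=> 0 : R) (0 : R) by exact: is_derive_cst.
  have u0 : `|u x - u 0| <= 0.
    have [x0|x0] := leP 0 x.
      have := @mean_value_bound _ u (fun=> 0) (fun=> 0) (fun=> 0) 0 x x0.
      rewrite subrr; apply => // [t /andP[t0 _]|t _]; last by rewrite normr0.
      have nx := normr_ge0 x; by apply: du; lra.
    rewrite distrC.
    have := @mean_value_bound _ u (fun=> 0) (fun=> 0) (fun=> 0) x 0 (ltW x0).
    rewrite subrr; apply => // [t /andP[xt _]|t _]; last by rewrite normr0.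
    by rewrite ltr0_norm // in xN xN'; apply: du; lra.
  move: u0; rewrite normr_le0 subr_eq0 => /eqP/rowP/(_ 0); rewrite !mxE /H; lra.
exists (fun x => H (`|x| + 1) x); split=> [|t]; first by rewrite /H subrr.
have tN : - (`|t| + 2) < t by have := ler_norm (- t); rewrite normrN; lra.
apply: near_eq_is_derive (dH _ _ tN); near=> s.
have : ball t 1 s by near: s; exact: nbhsx_ballx.
rewrite -ball_normE /= distrC => st.
have := ler_normD (s - t) t; rewrite subrK => h.
by apply: HE; lra.
Unshelve. all: by end_near. Qed.

Lemma antiderivative_row n (g : R -> 'rV[R]_n) : continuous g ->
  exists G : R -> 'rV[R]_n, G 0 = 0 /\ forall t : R, is_derive t 1 G (g t).
Proof.
move=> cg; have /choice[G GP] : forall i, exists G : R -> R,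
    G 0 = 0 /\ forall t : R, is_derive t 1 G (g t 0 i).
  move=> i; apply: antiderivative => t.
  exact: (continuous_comp (cg t) (@coord_continuous _ _ _ _ _ _)).
exists (fun t => \row_i G i t); split.
  by apply/rowP => i; rewrite !mxE; have [] := GP i.
move=> t; apply/is_derive1_row => i.
have -> : (fun s => (\row_i0 G i0 s) 0 i) = G i by apply/funext => s; rewrite mxE.
by have [] := GP i.
Qed.

(** Lowering u k by the remaining sum 2 D 2^-k gives a nondecreasing sequence,
   raising it by that amount a nonincreasing one. *)
Lemma geometric_limit (u : nat -> R) (D : R) :
  (forall k, `|u k.+1 - u k| <= D * (1/2) ^+ k) ->
  exists l, forall k, `|u k - l| <= 2 * D * (1/2) ^+ k.
Proof.
move=> uD; pose e k := 2 * D * (1/2) ^+ k : R.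
have ed k : e k - e k.+1 = D * (1/2) ^+ k by rewrite /e exprS; field.
pose a k := u k - e k; pose b k := u k + e k.
have aS k : a k <= a k.+1.
  by have := uD k; rewrite ler_norml -ed /a => /andP[]; lra.
have bS k : b k.+1 <= b k.
  by have := uD k; rewrite ler_norml -ed /b => /andP[]; lra.
have e0 k : 0 <= e k.
  have D0 : 0 <= D by have := le_trans (normr_ge0 _) (uD 0); rewrite expr0 mulr1.
  by rewrite mulr_ge0 // ?exprn_ge0 //; lra.
have am i j : (i <= j)%N -> a i <= a j.
  by elim: j => [|j IH]; [rewrite leqn0 => /eqP ->|rewrite leq_eqVlt => /predU1P[->//|/IH/le_trans]; apply].
have bm i j : (i <= j)%N -> b j <= b i.
  by elim: j => [|j IH]; [rewrite leqn0 => /eqP ->|rewrite leq_eqVlt => /predU1P[->//|/IH]; exact: le_trans].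
have ab i j : a i <= b j.
  apply: le_trans (am i _ (leq_maxl i j)) _; apply: le_trans (bm j _ (leq_maxr i j)).
  by have := e0 (maxn i j); rewrite /a /b; lra.
have sa : has_sup (range a).
  by split; [exists (a 0), 0|exists (b 0) => _ [i _ <-]].
exists (sup (range a)) => k.
have h1 : a k <= sup (range a) by apply: sup_upper_bound => //; exists k.
have h2 : sup (range a) <= b k by apply: sup_le_ub => [|_ [i _ <-]] //; exists (a 0), 0.
by move: h1 h2; rewrite -/(e k) /a /b ler_norml => h1 h2; apply/andP; split; lra.
Qed.

Lemma geometric_limit_row n (u : nat -> 'rV[R]_n) (D : R) :
  (forall k, `|u k.+1 - u k| <= D * (1/2) ^+ k) ->
  exists l, forall k, `|u k - l| <= 2 * D * (1/2) ^+ k.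
Proof.
move=> uD; have /choice[z zP] : forall i, exists z : R, forall k, `|u k 0 i - z| <= 2 * D * (1/2) ^+ k.
  move=> i; apply: geometric_limit => k; apply: le_trans (uD k).
  by have := row_coord_le (u k.+1 - u k) i; rewrite !mxE.
have D0 : 0 <= D by have := le_trans (normr_ge0 _) (uD 0); rewrite expr0 mulr1.
exists (\row_i z i) => k; apply: row_norm_le => [|i]; last by rewrite !mxE; exact: zP.
by rewrite !mulr_ge0 // exprn_ge0 //; lra.
Qed.

End Curves.

(** * Global solutions of Lipschitz equations *)

Section Picard.
Context {R : realType}.

Lemma half_pow_small (C e : R) : 0 < e -> exists k, C * (1/2) ^+ k < e.
Proof.
move=> e0; have [C0|C0] := leP C 0; first by exists 0; rewrite expr0; lra.
have h : (fun k => (1/2 : R) ^+ k) @ \oo --> (0 : R).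
  by apply: cvg_expr; rewrite ger0_norm; lra.
have : \forall k \near \oo, (1/2 : R) ^+ k < e / C.
  by apply: (cvgr_lt 0 h); rewrite divr_gt0.
by move=> [k _ /(_ k (leqnn k))]; rewrite ltr_pdivlMr // => kP; exists k; rewrite mulrC.
Qed.

(** The weight grows at the rate l in both time directions, so that integration
   from 0 divides it by l; a large l makes the Picard operator a contraction
   on the whole line. *)
Definition picard_weight (l t : R) : R := expR (l * t) + expR (- l * t).

Lemma picard_weight_ge1 l t : 1 <= picard_weight l t.
Proof.
rewrite /picard_weight; have [lt|lt] := leP 0 (l * t).
  by have := expR_ge0 (- l * t); have := ler_expR 0 (l * t); rewrite expR0 lt; lra.
have := expR_ge0 (l * t); have := ler_expR 0 (- l * t); rewrite expR0 mulNr; lra.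
Qed.

Lemma picard_weight_integral n (u u' : R -> 'rV[R]_n) (l C : R) : 0 < l -> 0 <= C ->
  u 0 = 0 -> (forall t : R, is_derive t 1 u (u' t)) ->
  (forall t, `|u' t| <= C * picard_weight l t) ->
  forall t, `|u t| <= C * picard_weight l t / l.
Proof.
move=> l0 C0 u0 du bu t.
pose W s := C / l * (expR (l * s) - expR (- l * s)).
have dW (s : R) : is_derive s 1 W (C * picard_weight l s).
  have -> : C * picard_weight l s = C / l * (l * expR (l * s) - (- l) * expR (- l * s)).
    by rewrite /picard_weight; field; rewrite gt_eqF.
  exact: is_deriveZ (is_deriveB (is_derive_exp _ _) (is_derive_exp _ _)).
have W0 : W 0 = 0 by rewrite /W !mulr0 subrr mulr0.
have Cl : 0 <= C / l by rewrite divr_ge0 // ltW.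
have Wl : W t <= C * picard_weight l t / l /\ - W t <= C * picard_weight l t / l.
  have -> : C * picard_weight l t / l = C / l * picard_weight l t by rewrite mulrAC.
  rewrite /W /picard_weight -mulrN.
  by split; apply: ler_wpM2l => //; have := expR_ge0 (l * t); have := expR_ge0 (- l * t); lra.
have [t0|t0] := leP 0 t.
  have := @mean_value_bound _ _ u u' W (fun s => C * picard_weight l s) 0 t t0.
  by rewrite u0 subr0 W0 subr0 => H; apply: le_trans Wl.1; apply: H.
have := @mean_value_bound _ _ u u' W (fun s => C * picard_weight l s) t 0 (ltW t0).
by rewrite u0 W0 !sub0r normrN => H; apply: le_trans Wl.2; apply: H.
Qed.

(** Successive Picard iterates differ by B 2^-k times the weight, hence converge
   locally uniformly, and the limit is a fixed point. *)
Lemma global_solution n (f : R -> 'rV[R]_n -> 'rV[R]_n) (L B : R) (y0 : 'rV[R]_n) :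
  0 <= L -> (forall t x y, `|f t x - f t y| <= L * `|x - y|) ->
  (forall y : R -> 'rV[R]_n, continuous y -> continuous (fun t => f t (y t))) ->
  (forall t, `|f t y0| <= B) ->
  exists y : R -> 'rV[R]_n, y 0 = y0 /\ forall t : R, is_derive t 1 y (f t (y t)).
Proof.
move=> L0 lipf cf Bf.
have /choice[I IP] : forall g : R -> 'rV[R]_n, exists G : R -> 'rV[R]_n,
    continuous g -> G 0 = 0 /\ forall t : R, is_derive t 1 G (g t).
  move=> g; have [/antiderivative_row[G GP]|ng] := pselect (continuous g); first by exists G.
  by exists (fun=> 0).
pose S (y : R -> 'rV[R]_n) t := y0 + I (fun s => f s (y s)) t.
have S0 y : continuous y -> S y 0 = y0.
  by move=> cy; rewrite /S (IP _ (cf y cy)).1 addr0.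
have dS y (t : R) : continuous y -> is_derive t 1 (S y) (f t (y t)).
  move=> cy; rewrite -[f t (y t)]add0r; apply: is_deriveD.
  exact: (IP _ (cf y cy)).2.
have cS y : continuous y -> continuous (S y).
  by move=> cy t; exact: is_derive1_continuous (dS y t cy).
pose Y k := iter k S (fun=> y0).
have cY k : continuous (Y k).
  by elim: k => [|k IH]; [move=> t; exact: cst_continuous|exact: cS].
pose l := 2 * (L + 1); have l0 : 0 < l by rewrite /l; lra.
pose w := picard_weight l.
have w1 t : 1 <= w t by exact: picard_weight_ge1.
have B0 : 0 <= B by exact: le_trans (normr_ge0 _) (Bf 0).
(* the Picard operator halves weighted distances: L / l < 1 / 2 *)
have SB y z C : continuous y -> continuous z -> 0 <= C ->
    (forall t, `|y t - z t| <= C * w t) -> forall t, `|S y t - S z t| <= C / 2 * w t.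
  move=> cy cz C0 yz t.
  have h : forall t, `|(S y - S z) t| <= (L * C) * w t / l.
    apply: (@picard_weight_integral _ _ (fun t => f t (y t) - f t (z t))) => //.
    - exact: mulr_ge0.
    - by rewrite !fctE !S0 // subrr.
    - by move=> s; apply: is_deriveB; exact: dS.
    - by move=> s; apply: le_trans (lipf _ _ _) _; rewrite -mulrA ler_wpM2l // yz.
  apply: le_trans (h t) _; rewrite ler_pdivrMr //.
  have -> : C / 2 * w t * l = L * C * w t + C * w t by rewrite /l; field.
  by rewrite lerDl mulr_ge0 // (le_trans _ (w1 t)).
have bY k t : `|Y k.+1 t - Y k t| <= B * (1/2) ^+ k * w t.
  elim: k t => [|k IH] t.
    rewrite expr0 mulr1 -[Y 0 t]addr0 opprD addrA -[Y 1 t]/(S (fun=> y0) t).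
    have h : forall t, `|(S (fun=> y0) - cst y0) t| <= B * w t / l.
      apply: (@picard_weight_integral _ _ (fun t => f t y0)) => //.
      - by rewrite !fctE S0 ?subrr // => s; exact: cst_continuous.
      - move=> s; rewrite -[f s y0]subr0; apply: is_deriveB.
        by apply: dS => r; exact: cst_continuous.
      - by move=> s; apply: le_trans (Bf s) _; rewrite ler_peMr.
    rewrite subr0; apply: le_trans (h t) _; rewrite ler_pdivrMr //.
    have Bw : 0 <= B * w t by rewrite mulr_ge0 // (le_trans _ (w1 t)).
    by rewrite ler_peMr // /l; lra.
  have -> : B * (1/2) ^+ k.+1 = B * (1/2) ^+ k / 2 by rewrite exprS; field.
  apply: (SB (Y k.+1) (Y k) _ (cY _) (cY _)) => //.
  by rewrite mulr_ge0 // exprn_ge0 //; lra.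
have ck k : 0 <= (1/2 : R) ^+ k by rewrite exprn_ge0 //; lra.
have /choice[y yP] : forall t, exists z : 'rV[R]_n, forall k, `|Y k t - z| <= 2 * (B * w t) * (1/2) ^+ k.
  by move=> t; apply: geometric_limit_row => k; rewrite mulrAC; exact: bY.
have cy : continuous y.
  move=> t; apply/cvgrPdist_lt => e e0.
  pose M := 2 * expR (l * (`|t| + 1)).
  have [k kP] := @half_pow_small (2 * (B * M)) (e / 3) ltac:(lra).
  have wM s : `|t - s| < 1 -> w s <= M.
    move=> st; have : `|s| <= `|t| + 1.
      by have := ler_normB t (t - s); rewrite subKr; lra.
    move=> sM; rewrite /w /picard_weight /M mulr2n mulrDl mul1r; apply: lerD.
      by rewrite ler_expR ler_pM2l //; have := ler_norm s; lra.
    by rewrite ler_expR mulNr -mulrN ler_pM2l //; have := ler_norm (- s); rewrite normrN; lra.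
  have yk s : `|t - s| < 1 -> `|Y k s - y s| < e / 3.
    move=> st; apply: le_lt_trans (yP s k) (le_lt_trans _ kP).
    rewrite ler_wpM2r ?ck // ler_wpM2l // ler_wpM2l //; exact: wM.
  near=> s.
  have st : `|t - s| < 1.
    near: s; apply/nbhs_ballP; exists 1 => //=.
  have h1 : `|Y k t - Y k s| < e / 3.
    near: s; apply: (cvgrPdist_lt _ _).1 (cY k t) _ _; lra.
  have h2 := yk t ltac:(by rewrite subrr normr0); have h3 := yk s st.
  have -> : y t - y s = (Y k t - Y k s) - (Y k t - y t) + (Y k s - y s).
    by apply/rowP => i; rewrite !mxE; lra.
  have := ler_normD ((Y k t - Y k s) - (Y k t - y t)) (Y k s - y s).
  have := ler_normB (Y k t - Y k s) (Y k t - y t); lra.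
have yS : y = S y.
  apply/funext => t; apply/eqP; rewrite -subr_eq0 -normr_le0; apply/ler_addgt0Pl => e e0.
  have [k kP] := @half_pow_small (2 * (B * w t)) (e / 2) ltac:(lra).
  have h1 : `|S (Y k) t - S y t| <= 2 * B * (1/2) ^+ k / 2 * w t.
    apply: SB => // [|s]; first by rewrite !mulr_ge0.
    by apply: le_trans (yP s k) _; rewrite mulrA mulrAC.
  have h2 := yP t k.+1.
  rewrite addr0; have -> : y t - S y t = (S (Y k) t - S y t) - (Y k.+1 t - y t).
    by rewrite -[S (Y k) t]/(Y k.+1 t); apply/rowP => i; rewrite !mxE; lra.
  have := ler_normB (S (Y k) t - S y t) (Y k.+1 t - y t).
  have : 2 * (B * w t) * (1 / 2) ^+ k.+1 = 2 * B * (1 / 2) ^+ k / 2 * w t by rewrite exprS; field.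
  have : 2 * B * (1 / 2) ^+ k / 2 * w t = (2 * (B * w t) * (1 / 2) ^+ k) / 2 by field.
  lra.
by exists y; split=> [|t]; rewrite {1}yS; [exact: S0|exact: dS].
Unshelve. all: by end_near. Qed.

End Picard.

(** * Bounds on compact convex sets *)

Section Lipschitz.
Context {R : realType}.

Definition convex (V : normedModType R) (K : set V) : Prop :=
  forall x y (t : R), K x -> K y -> 0 <= t <= 1 -> K (x + t *: (y - x)).

Lemma compact_bound (V W : normedModType R) (K : set V) (f : V -> W) : compact K ->
  (forall x, K x -> {for x, continuous f}) ->
  exists2 M : R, 0 <= M & forall x, K x -> `|f x| <= M.
Proof.
move=> cK cf.
have : bounded_set (f @` K).
  apply/compact_bounded/continuous_compact => //.
  by apply/continuous_in_subspaceT => x; rewrite inE; exact: cf.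
move=> [M [Mr MP]]; exists (`|M| + 1); first by rewrite addr_ge0.
move=> x Kx; apply: (MP (`|M| + 1)); last by exists x.
by have := ler_norm M; lra.
Qed.

Lemma diff_basis_bound n (W : normedModType R) (df : {linear 'rV[R]_n -> W}) (M : 'I_n -> R) :
  (forall i, `|df 'e_i| <= M i) -> forall v, `|df v| <= (\sum_i M i) * `|v|.
Proof.
move=> dM v; rewrite linear_rowE mulr_suml.
apply: le_trans (ler_norm_sum _ _ _) _; apply: ler_sum => i _.
by rewrite normrZ mulrC ler_pM // row_coord_le.
Qed.

Lemma diffB_basis_bound n (W : normedModType R) (A B : {linear 'rV[R]_n -> W}) (M : 'I_n -> R) :
  (forall i, `|A 'e_i - B 'e_i| <= M i) ->
  forall v, `|A v - B v| <= (\sum_i M i) * `|v|.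
Proof.
move=> dM v; rewrite (linear_rowE A) (linear_rowE B) -sumrB mulr_suml.
apply: le_trans (ler_norm_sum _ _ _) _; apply: ler_sum => i _.
by rewrite -scalerBr normrZ mulrC ler_pM // row_coord_le.
Qed.

Lemma diff_bound n m (O K : set 'rV[R]_n) (X : 'rV[R]_n -> 'rV[R]_m) :
  compact K -> K `<=` O -> class_C 1 O X ->
  exists2 L : R, 0 <= L & forall x, K x -> forall v, `|'d X x v| <= L * `|v|.
Proof.
move=> cK KO [_ CX].
have /choice[M MP] : forall i, exists M : R, 0 <= M /\ forall x, K x -> `|'d X x 'e_i| <= M.
  move=> i; have [|M M0 MP] := @compact_bound _ _ K (fun x => 'd X x 'e_i) cK.
    by move=> x /KO; exact: CX.
  by exists M.
exists (\sum_i M i) => [|x Kx v]; first by apply: sumr_ge0 => i _; exact: (MP i).1.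
by apply: diff_basis_bound => i; exact: (MP i).2.
Qed.

Lemma lipschitz_convex (V : normedModType R) m (K : set V) (X : V -> 'rV[R]_m) L :
  convex K -> (forall x, K x -> differentiable X x) ->
  (forall x, K x -> forall v, `|'d X x v| <= L * `|v|) ->
  forall x y, K x -> K y -> `|X y - X x| <= L * `|y - x|.
Proof.
move=> cvK dX bX x y Kx Ky; apply: mean_value_segment => t t01.
  exact/dX/cvK.
exact/bX/cvK.
Qed.

Lemma diff_subr_linear (V W : normedModType R) (X : V -> W) (D : {linear V -> W}) z :
  continuous D -> differentiable X z ->
  differentiable (fun y => X y - D y) z /\
  forall v, 'd (fun y => X y - D y) z v = 'd X z v - D v.
Proof.
move=> cD dX; have dD := linear_differentiable z cD.
split=> [|v]; first exact: differentiableB dX dD.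
apply: etrans (congr1 (fun h => h v) (diffB dX dD)) _.
exact: (congr1 (fun h : V -> W => 'd X z v - h v) (diff_lin z cD)).
Qed.

(** The mean value bound for y |-> X y - dX_x y, whose differential is small near x
   because the differential of X is Lipschitz on K. *)
Lemma taylor_bound n m (O K : set 'rV[R]_n) (X : 'rV[R]_n -> 'rV[R]_m) :
  compact K -> convex K -> K `<=` O -> class_C 2 O X ->
  exists2 L : R, 0 <= L & forall x y, K x -> K y ->
    `|X y - X x - 'd X x (y - x)| <= L * `|y - x| ^+ 2.
Proof.
move=> cK cvK KO [dX CX].
have /choice[M MP] : forall i, exists M : R, 0 <= M /\ forall x y, K x -> K y ->
    `|'d X y 'e_i - 'd X x 'e_i| <= M * `|y - x|.
  move=> i; have [L L0 LP] := diff_bound cK KO (CX 'e_i).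
  exists L; split => // x y Kx Ky.
  exact: (lipschitz_convex cvK (fun z Kz => (CX 'e_i).1 z (KO z Kz)) LP).
have M0 : 0 <= \sum_i M i by apply: sumr_ge0 => i _; exact: (MP i).1.
exists (\sum_i M i) => // x y Kx Ky.
pose g z := X z - 'd X x z.
have -> : X y - X x - 'd X x (y - x) = g y - g x.
  rewrite /g linearB; apply/rowP => i; rewrite !mxE; lra.
have dg z : K z -> differentiable g z /\ forall v, 'd g z v = 'd X z v - 'd X x v.
  by move=> /KO/dX dz; apply: diff_subr_linear => //; exact/diff_continuous/dX/KO.
apply: mean_value_segment => t t01; have Kz := cvK _ _ t Kx Ky t01.
  by have [] := dg _ Kz.
rewrite (dg _ Kz).2; set z := x + t *: (y - x).
have zx : `|z - x| <= `|y - x|.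
  rewrite /z addrC addKr normrZ; case/andP: t01 => t0 t1.
  by rewrite ger0_norm // ler_piMl.
have H := @diffB_basis_bound _ _ ('d X z) ('d X x) (fun i => M i * `|z - x|).
apply: le_trans (H _ (y - x)) _; first by move=> i; exact: (MP i).2.
rewrite -mulr_suml.
by rewrite expr2 mulrA ler_wpM2r // ler_wpM2l.
Qed.

End Lipschitz.

(** * Smooth dependence on parameters *)

Section Dependence.
Context {R : realType}.

Lemma continuous_diff_comp n m (O : set 'rV[R]_n) (X : 'rV[R]_n -> 'rV[R]_m)
    (x v : R -> 'rV[R]_n) : open O -> class_C 1 O X -> (forall t, O (x t)) ->
  continuous x -> continuous v -> continuous (fun t => 'd X (x t) (v t)).
Proof.
move=> oO CX xO cx cv t.
suff : class_C 0 (@setT R) (fun t => 'd X (x t) (v t)) by exact.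
by apply: class_C_diff openT oO _ _ _ CX => // s _; [exact: cx|exact: cv].
Qed.

Definition clamp (a b t : R) : R := Num.max a (Num.min b t).

Lemma clamp_in a b t : a <= b -> a <= clamp a b t <= b.
Proof.
by move=> ab; rewrite /clamp le_max lexx /= ge_max ab /= ge_min lexx.
Qed.

Lemma clamp_id a b t : a <= t <= b -> clamp a b t = t.
Proof. by case/andP=> a_t tb; rewrite /clamp min_r // max_r. Qed.

Lemma clamp_lipschitz a b s t : `|clamp a b s - clamp a b t| <= `|s - t|.
Proof.
rewrite /clamp.
have [bs|bs] := leP b s; have [bt|bt] := leP b t; rewrite ?(min_l, min_r) //;
 rewrite /Num.max; repeat case: ifP => ?; rewrite ler_norml;
 have := ler_norm (s - t); have := ler_norm (- (s - t)); rewrite normrN; lra.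
Qed.

Lemma clamp_continuous a b : continuous (clamp a b).
Proof.
move=> t; apply/cvgrPdist_lt => e e0; near=> s.
apply: le_lt_trans (clamp_lipschitz a b t s) _.
near: s; apply/nbhs_ballP; exists e => //=.
Unshelve. all: by end_near. Qed.

(** Parameter dependence at first order: the derivative of the flow solves the
   equation linearised along the trajectory, and the Taylor remainder of X is
   quadratic, so that Gronwall bounds the error by a quadratic term. *)
Lemma solution_differentiable n m (O K : set 'rV[R]_n) (P : set 'rV[R]_m)
    (X : 'rV[R]_n -> 'rV[R]_n) (phi : R -> 'rV[R]_m -> 'rV[R]_n) (T : R) :
  open O -> open P -> compact K -> convex K -> K `<=` O -> class_C 2 O X -> 0 <= T ->
  (forall (t : R) p, 0 <= t <= T -> P p -> K (phi t p)) ->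
  (forall (t : R) p, 0 <= t <= T -> P p -> is_derive t 1 (phi ^~ p) (X (phi t p))) ->
  (forall p, P p -> differentiable (phi 0) p) ->
  exists psi : R -> 'rV[R]_m -> 'rV[R]_m -> 'rV[R]_n, exists2 G : R, 0 <= G &
  [/\ forall p w, P p -> psi 0 p w = 'd (phi 0) p w,
      forall (t : R) p w, 0 <= t <= T -> P p ->
        is_derive t 1 (fun s => psi s p w) ('d X (phi t p) (psi t p w)),
      forall (t : R) p w, 0 <= t <= T -> P p -> `|psi t p w| <= G * `|'d (phi 0) p w| &
      forall (t : R) p, 0 <= t <= T -> P p ->
        differentiable (phi t) p /\ forall w, 'd (phi t) p w = psi t p w].
Proof.
move=> oO oP cK cvK KO CX T0 phiK dphi dphi0.
have CX1 := class_CS CX.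
have [L L0 LP] := diff_bound cK KO CX1.
have [L2 L20 L2P] := taylor_bound cK cvK KO CX.
have lipX := lipschitz_convex cvK (fun x Kx => CX1.1 x (KO x Kx)) LP.
have TT := clamp_in _ T0.
(* the linearised equation along the trajectory, with time clamped to [0, T] so
   that its coefficients are defined and bounded on the whole line; solving it
   for the basis vectors only makes psi linear in w by construction *)
have /choice[y yP] : forall pi : 'rV[R]_m * 'I_m, exists y : R -> 'rV[R]_n, P pi.1 ->
    y 0 = 'd (phi 0) (pi.1) 'e_(pi.2) /\
    forall t : R, is_derive t 1 y ('d X (phi (clamp 0 T t) pi.1) (y t)).
  move=> [p i] /=; have [Pp|nPp] := pselect (P p); last by exists (fun=> 0).
  have Kc t : K (phi (clamp 0 T t) p) by exact: phiK.
  have [||||y yP] := @global_solution R n (fun t => 'd X (phi (clamp 0 T t) p)) L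
    (L * `|'d (phi 0) p 'e_i|) ('d (phi 0) p 'e_i) => //.
  - by move=> t x z; rewrite -linearB; exact: LP.
  - move=> z cz; apply: continuous_diff_comp oO CX1 _ _ cz; first by move=> t; exact: KO.
    move=> t; apply: (@continuous_comp _ _ _ (clamp 0 T) (phi ^~ p)).
      exact: clamp_continuous.
    exact: is_derive1_continuous (dphi _ p (TT t) Pp).
  - by move=> t; exact: LP.
  by exists y.
pose psi (t : R) (p w : 'rV[R]_m) : 'rV[R]_n := \sum_i w 0 i *: y (p, i) t.
pose G := gronwall_const L T; have G0 : 0 <= G by exact: gronwall_const_ge0.
have psi0 p w : P p -> psi 0 p w = 'd (phi 0) p w.
  move=> Pp; rewrite linear_rowE; apply: eq_bigr => i _.
  by rewrite (yP (p, i) Pp).1.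
have dpsi (t : R) p w : 0 <= t <= T -> P p ->
    is_derive t 1 (fun s => psi s p w) ('d X (phi t p) (psi t p w)).
  move=> tT Pp; rewrite /psi linear_sum.
  have -> : (fun s => \sum_i w 0 i *: y (p, i) s) = \sum_i (fun s => w 0 i *: y (p, i) s).
    by apply/funext => s; rewrite fct_sumE.
  apply: is_derive_sum => i; rewrite linearZZ.
  apply: is_deriveZ; have := (yP (p, i) Pp).2 t; by rewrite clamp_id.
have bpsi (t : R) p w : 0 <= t <= T -> P p -> `|psi t p w| <= G * `|'d (phi 0) p w|.
  move=> tT Pp; rewrite -psi0 // -[`|psi 0 p w|]addr0.
  apply: (@gronwall _ _ (fun s => psi s p w) _ L T 0 L0 (lexx 0) _ _ t tT).
    by move=> s sT; exact: dpsi.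
  by move=> s sT; rewrite addr0; apply: LP; exact: phiK.
exists psi, G => //; split => // t p tT Pp.
have psil : linear (psi t p).
  move=> a u v; rewrite /psi scaler_sumr -big_split; apply: eq_bigr => i _.
  by rewrite !mxE scalerDl scalerA.
pose psiL : {linear 'rV[R]_m -> 'rV[R]_n} := HB.pack (psi t p) (GRing.isLinear.Build _ _ _ _ _ psil).
suff [dp E] : differentiable (phi t) p /\ 'd (phi t) p = psiL :> (_ -> _).
  by split => // w; rewrite E.
have dc0 : continuous ('d (phi 0) p) by exact/diff_continuous/dphi0.
have [k k0 kP] := linear_lipschitz dc0.
apply: diff_eps => [|e e0]; first exact: row_linear_continuous.
(* half of e for the initial error, half for the Taylor remainder *)
pose e1 := e / (2 * (G + 1)).
have e10 : 0 < e1 by rewrite divr_gt0 // mulr_gt0 //; lra.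
pose C := G * (L2 * (G * (e1 + k)) ^+ 2).
have C0 : 0 <= C by rewrite mulr_ge0 // mulr_ge0 // exprn_ge0 // mulr_ge0 // addr_ge0 ?ltW.
near=> h.
have Ph : P (p + h).
  by near: h; exact: (@nbhs0_addl _ _ P p (open_nbhs_nbhs (conj oP Pp))).
have h0 : `|phi 0 (p + h) - phi 0 p - 'd (phi 0) p h| <= e1 * `|h|.
  near: h; exact: diff_epsP (dphi0 p Pp) e1 e10.
have hsmall : C * `|h| <= e / 2.
  have : `|h| <= (e / 2) / (C + 1).
    near: h; apply/nbhs_ballP; exists ((e / 2) / (C + 1)) => /=; first by rewrite divr_gt0 //; lra.
    by move=> h; rewrite -ball_normE /= sub0r normrN => /ltW.
  have C1 : 0 < C + 1 by rewrite ltr_wpDl.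
  rewrite ler_pdivlMr // mulrDr mulr1 mulrC => hC.
  by apply: le_trans hC; rewrite lerDl.
have hdist0 : `|phi 0 (p + h) - phi 0 p| <= (e1 + k) * `|h|.
  rewrite -[X in `|X|](subrK ('d (phi 0) p h)) mulrDl.
  by apply: le_trans (ler_normD _ _) (lerD h0 (kP h)).
have hdist s : 0 <= s <= T -> `|phi s (p + h) - phi s p| <= G * (e1 + k) * `|h|.
  move=> sT; rewrite -mulrA; apply: le_trans (ler_wpM2l G0 hdist0).
  rewrite -[`|phi 0 (p + h) - phi 0 p|]addr0.
  apply: (@gronwall _ _ (phi ^~ (p + h) - phi ^~ p) (fun s => X (phi s (p + h)) - X (phi s p)) L T 0) => // r rT.
    by apply: is_deriveB; exact: dphi.
  by rewrite addr0; apply: lipX; exact: phiK.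
pose u s := phi s (p + h) - phi s p - psi s p h.
pose eps := L2 * (G * (e1 + k) * `|h|) ^+ 2.
have eps0 : 0 <= eps by rewrite mulr_ge0 // exprn_ge0 // !mulr_ge0 // addr_ge0 // ltW.
have ub : `|u t| <= G * (`|u 0| + eps).
  apply: (@gronwall _ _ u (fun s => X (phi s (p + h)) - X (phi s p) - 'd X (phi s p) (psi s p h)) L T eps) => // s sT.
    by apply: is_deriveB (dpsi s p h sT Pp); apply: is_deriveB; exact: dphi.
  set a := phi s p; set b := phi s (p + h).
  have -> : X b - X a - 'd X a (psi s p h) = (X b - X a - 'd X a (b - a)) + 'd X a (u s).
    have -> : 'd X a (u s) = 'd X a (b - a) - 'd X a (psi s p h) by exact: linearB.
    by rewrite addrA subrK.
  rewrite addrC; apply: le_trans (ler_normD _ _) _; apply: lerD.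
    by apply: LP; exact: phiK.
  apply: le_trans (L2P a b _ _) _; [exact: phiK|exact: phiK|].
  by rewrite /eps ler_wpM2l // ler_pXn2r ?nnegrE // ?hdist // !mulr_ge0 // addr_ge0 // ltW.
rewrite -/(u t); apply: le_trans ub _.
have u0 : `|u 0| <= e1 * `|h| by rewrite /u psi0.
have hn := normr_ge0 h.
have -> : G * (`|u 0| + eps) = G * `|u 0| + C * `|h| * `|h| by rewrite /eps /C; ring.
have a1 : G * `|u 0| <= e / 2 * `|h|.
  apply: le_trans (ler_wpM2l G0 u0) _; rewrite mulrA ler_wpM2r // /e1.
  have G1 : 0 < 2 * (G + 1) by rewrite mulr_gt0 // ltr_wpDl.
  have Ge : 0 <= e by exact: ltW.
  rewrite mulrA ler_pdivrMr //; clear -Ge; lra.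
have a2 : C * `|h| * `|h| <= e / 2 * `|h| by exact: ler_wpM2r.
by rewrite [e in leRHS]splitr mulrDl; exact: lerD.
Unshelve. all: by end_near. Qed.

End Dependence.

Section SmoothDependence.
Context {R : realType}.

Lemma open_sub_preimage (T U : topologicalType) (P : set T) (A : set U) (g : T -> U) :
  open P -> open A -> (forall p, P p -> {for p, continuous g}) ->
  open (P `&` g @^-1` A).
Proof.
move=> oP oA cg; rewrite openE => p [Pp Ap]; apply: filterI.
  exact: open_nbhs_nbhs.
by apply: cg => //; exact: open_nbhs_nbhs.
Qed.

Lemma is_derive1_row_mx n m (y : R -> 'rV[R]_n) (z : R -> 'rV[R]_m) (t : R) d e :
  is_derive t 1 y d -> is_derive t 1 z e ->
  is_derive t 1 (fun s => row_mx (y s) (z s)) (row_mx d e).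
Proof.
move=> /is_derive1_row dy /is_derive1_row dz; apply/is_derive1_row => i.
case: (split_ordP i) => j ->.
  have -> : (fun s => row_mx (y s) (z s) 0 (lshift m j)) = fun s => y s 0 j.
    by apply/funext => s; rewrite row_mxEl.
  by rewrite row_mxEl.
have -> : (fun s => row_mx (y s) (z s) 0 (rshift n j)) = fun s => z s 0 j.
  by apply/funext => s; rewrite row_mxEr.
by rewrite row_mxEr.
Qed.

(** The complete lift of X to pairs of a point and a tangent vector. *)
Definition linearised n (X : 'rV[R]_n -> 'rV[R]_n) (z : 'rV[R]_(n + n)) : 'rV[R]_(n + n) :=
  row_mx (X (lsubmx z)) ('d X (lsubmx z) (rsubmx z)).

Lemma lsubmx_continuous n m : continuous (lsubmx : 'rV[R]_(n + m) -> 'rV[R]_n).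
Proof. exact: continuous_lsubmx. Qed.

Lemma rsubmx_continuous n m : continuous (rsubmx : 'rV[R]_(n + m) -> 'rV[R]_m).
Proof. exact: continuous_rsubmx. Qed.

Lemma open_lsubmx n m (O : set 'rV[R]_n) : open O -> open ((lsubmx : 'rV[R]_(n + m) -> 'rV[R]_n) @^-1` O).
Proof. by move=> oO; apply: open_comp => // z _; exact: lsubmx_continuous. Qed.

Lemma smooth_linearised n (O : set 'rV[R]_n) (X : 'rV[R]_n -> 'rV[R]_n) : open O ->
  smooth_on O X -> smooth_on ((lsubmx : 'rV[R]_(n + n) -> 'rV[R]_n) @^-1` O) (linearised X).
Proof.
move=> oO sX k; have oO' := @open_lsubmx n n O oO.
apply: class_C_row_mx => //.
  exact: (class_C_comp_row oO' oO _ (class_C_lsubmx _ _) (sX k)).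
exact: (class_C_diff oO' oO _ (class_C_lsubmx _ _) (class_C_rsubmx _ _) (sX k.+1)).
Qed.

Lemma compact_times_ball n m (K : set 'rV[R]_n) (C : R) : compact K ->
  compact [set z : 'rV[R]_(n + m) | K (lsubmx z) /\ `|rsubmx z| <= C].
Proof.
move=> cK; apply: bounded_closed_compact.
  have [M [Mr MP]] := compact_bounded cK.
  exists (Num.max M C); split; first exact: num_real.
  move=> x Mx z [/(MP x)/= Kz zC] /=.
  have xM : M < x by apply: le_lt_trans Mx; rewrite le_max lexx.
  have xC : C < x by apply: le_lt_trans Mx; rewrite le_max lexx orbT.
  rewrite -[z]hsubmxK; apply: row_mx_norm_le; first exact: Kz.
  exact: le_trans zC (ltW xC).
apply: (@closedI _ (lsubmx @^-1` K) ((fun z : 'rV[R]_(n + m) => `|rsubmx z|) @^-1` [set x | x <= C])).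
  apply: closed_comp; first by move=> z _; exact: lsubmx_continuous.
  exact: compact_closed (@norm_hausdorff _ _) cK.
apply: closed_comp; last exact: closed_le.
move=> z _; apply: (@continuous_comp _ _ _ (rsubmx : 'rV[R]_(n + m) -> _) (fun x => `|x|)).
  exact: rsubmx_continuous.
exact: norm_continuous.
Qed.

Lemma convex_times_ball n m (K : set 'rV[R]_n) (C : R) : convex K ->
  convex [set z : 'rV[R]_(n + m) | K (lsubmx z) /\ `|rsubmx z| <= C].
Proof.
move=> cvK x y t [Kx xC] [Ky yC] t01; split.
  have -> : lsubmx (x + t *: (y - x)) = lsubmx x + t *: (lsubmx y - lsubmx x).
    by apply/rowP => i; rewrite !mxE.
  exact: cvK.
have -> : rsubmx (x + t *: (y - x)) = (1 - t) *: rsubmx x + t *: rsubmx y.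
  by apply/rowP => i; rewrite !mxE; lra.
case/andP: t01 => t0 t1; have t1' : 0 <= 1 - t by lra.
apply: le_trans (ler_normD _ _) _; rewrite !normrZ !ger0_norm //.
by have := ler_wpM2l t0 yC; have := ler_wpM2l t1' xC; lra.
Qed.

(** Induction on the class: a directional derivative of the flow in the
   parameter is the second component of a solution of the linearised system,
   and the latter is as regular in the parameter as the induction hypothesis
   says. Quantifying over all systems at once is what makes this go through. *)
Lemma solution_class_C k : forall n m (O K : set 'rV[R]_n) (P : set 'rV[R]_m)
    (X : 'rV[R]_n -> 'rV[R]_n) (phi : R -> 'rV[R]_m -> 'rV[R]_n) (T : R),
  open O -> open P -> compact K -> convex K -> K `<=` O -> smooth_on O X -> 0 <= T ->
  (forall (t : R) p, 0 <= t <= T -> P p -> K (phi t p)) ->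
  (forall (t : R) p, 0 <= t <= T -> P p -> is_derive t 1 (phi ^~ p) (X (phi t p))) ->
  smooth_on P (phi 0) -> forall t, 0 <= t <= T -> class_C k P (phi t).
Proof.
elim: k => [|k IH] n m O K P X phi T oO oP cK cvK KO sX T0 phiK dphi sphi0 t tT.
  have [psi [G G0 [_ _ _ dpsi]]] :=
    solution_differentiable oO oP cK cvK KO (sX 2) T0 phiK dphi (sphi0 1).1.
  by move=> p Pp; apply: differentiable_continuous; have [] := dpsi t p tT Pp.
have [psi [G G0 [psi0 dpsi bpsi Dpsi]]] :=
  solution_differentiable oO oP cK cvK KO (sX 2) T0 phiK dphi (sphi0 1).1.
split=> [p Pp|w]; first by have [] := Dpsi t p tT Pp.
apply: class_C_local => p0 Pp0.
(* near p0 the second components stay in a fixed ball, as the induction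
   hypothesis wants a compact convex set *)
pose C := `|'d (phi 0) p0 w| + 1.
pose P' := P `&` (fun p => `|'d (phi 0) p w|) @^-1` [set x | x < C].
have oP' : open P'.
  apply: open_sub_preimage => // p Pp.
  apply: (@continuous_comp _ _ _ (fun p => 'd (phi 0) p w) (fun x => `|x|)).
    exact: (sphi0 1).2 w p Pp.
  exact: norm_continuous.
exists P'; first by split => //=; rewrite /C; lra.
pose phi' s p := row_mx (phi s p) (psi s p w).
have C1 : class_C k P' (phi' t).
  apply: (IH _ _ _ _ P' (linearised X) phi' T (open_lsubmx (m := n) oO) oP'
    (@compact_times_ball n n K (G * C) cK) (@convex_times_ball n n K (G * C) cvK) _ (smooth_linearised oO sX) T0) => //.
  - by move=> z [Kz _]; exact: KO.
  - move=> s p sT [Pp /= pC]; rewrite row_mxKl row_mxKr; split; first exact: phiK.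
    by apply: le_trans (bpsi s p w sT Pp) _; rewrite ler_wpM2l // ltW.
  - move=> s p sT [Pp _]; rewrite /linearised row_mxKl row_mxKr.
    by apply: is_derive1_row_mx; [exact: dphi|exact: dpsi].
  - move=> j; have s1 : class_C j P' (phi 0) by apply: class_C_subset (sphi0 j) => p [].
    have s2 : class_C j P' (fun p => 'd (phi 0) p w).
      by apply: class_C_subset ((sphi0 j.+1).2 w) => p [].
    apply: class_C_ext oP' _ (class_C_row_mx oP' s1 s2) => p; rewrite inE => -[Pp _].
    by rewrite /phi' psi0.
have C2 : class_C k P' (rsubmx \o phi' t).
  by apply: (class_C_comp_row (B := setT)) C1 _ => //; [exact: openT|exact: class_C_rsubmx].
apply: class_C_ext oP' _ C2 => p; rewrite inE => -[Pp _] /=.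
by rewrite row_mxKr; have [_ ->] := Dpsi t p tT Pp.
Qed.

End SmoothDependence.

(** * Smoothness of inverses *)

Section Inverse.
Context {R : realType}.

(** Along a vector in the kernel of the differential, E would move points by
   o(t), which contradicts the expansion. *)
Lemma expanding_diff_inj n (W : normedModType R) (O : set 'rV[R]_n) (E : 'rV[R]_n -> W) (c : R) :
  open O -> 0 < c -> (forall p q, O p -> O q -> c * `|p - q| <= `|E p - E q|) ->
  forall p, O p -> differentiable E p -> forall v, 'd E p v = 0 -> v = 0.
Proof.
move=> oO c0 cE p Op dE v dv0; apply/eqP/negPn/negP => v0.
have nv : 0 < `|v| by rewrite normr_gt0.
have c2 : 0 < c / 2 by lra.
have := diff_epsP dE c2; have : \forall h \near (0 : 'rV[R]_n), O (p + h).
  by apply: nbhs0_addl; exact: open_nbhs_nbhs.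
move=> /filterI H /H {H} /nbhs_ballP[r /= r0 rP].
pose a := r / (2 * `|v|).
have a0 : 0 < a by rewrite divr_gt0 // mulr_gt0.
have [] := rP (a *: v).
  rewrite -ball_normE /= sub0r normrN normrZ gtr0_norm //.
  have -> : a * `|v| = r / 2 by rewrite /a; field; rewrite gt_eqF.
  by lra.
move=> Oh; rewrite linearZZ dv0 scaler0 subr0 => hE.
have := cE _ _ Oh Op; rewrite addrC addKr => hc.
have : 0 < `|a *: v| by rewrite normrZ mulr_gt0 // normr_gt0 gt_eqF.
have := le_trans hc hE; nra.
Qed.

Lemma det_class_C (V : normedModType R) n k (O : set V) (A : V -> 'M[R]_n) : open O ->
  (forall i j, class_C k O (fun x => A x i j)) -> class_C k O (fun x => \det (A x)).
Proof.
move=> oO CA; apply: class_C_sum => // s _; apply: class_CM => //; first exact: class_C_cst.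
exact: class_C_prod.
Qed.

Lemma invmx_class_C (V : normedModType R) n k (O : set V) (A : V -> 'M[R]_n) : open O ->
  (forall x, O x -> A x \in unitmx) ->
  (forall i j, class_C k O (fun x => A x i j)) ->
  forall i j, class_C k O (fun x => invmx (A x) i j).
Proof.
move=> oO uA CA i j.
have C1 : class_C k O (fun x => (\det (A x))^-1).
  apply: class_CV => // [x Ox|]; last exact: det_class_C.
  by have := uA x Ox; rewrite unitmxE unitfE.
have C2 : class_C k O (fun x => \adj (A x) i j).
  have C3 : class_C k O (fun x => (-1) ^+ (j + i) * \det (row' j (col' i (A x)))).
    apply: class_CM => //; first exact: class_C_cst.
    apply: det_class_C => // a b; apply: class_C_ext oO _ (CA (lift j a) (lift i b)) => x _.
    by rewrite !mxE.
  by apply: class_C_ext oO _ C3 => x _; rewrite mxE.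
apply: class_C_ext oO _ (class_CM oO C1 C2) => x; rewrite inE => Ox.
by rewrite /invmx (uA _ Ox) [RHS]mxE.
Qed.

(** The smooth half of the inverse function theorem. That E expands distances
   gives both the continuity of the inverse and the injectivity of the
   differential; existence of the inverse is a separate matter. *)
Lemma inverse_smooth n (O O' : set 'rV[R]_n) (E g : 'rV[R]_n -> 'rV[R]_n) (c : R) :
  open O -> open O' -> 0 < c -> smooth_on O E ->
  (forall p q, O p -> O q -> c * `|p - q| <= `|E p - E q|) ->
  (forall y, O' y -> O (g y) /\ E (g y) = y) -> smooth_on O' g.
Proof.
move=> oO oO' c0 sE cE gP.
have dE p : O p -> differentiable E p by exact: (sE 1).1.
have glip y z : O' y -> O' z -> c * `|g y - g z| <= `|y - z|.
  move=> /gP[Oy {2}<-] /gP[Oz {2}<-]; exact: cE.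
pose J y := lin1_mx ('d E (g y)).
have JE y v : v *m J y = 'd E (g y) v by rewrite mul_rV_lin1.
have uJ y : O' y -> J y \in unitmx.
  move=> /gP[Oy _]; rewrite -row_free_unit; apply/inj_row_free => v; rewrite JE.
  exact: expanding_diff_inj oO c0 cE _ Oy (dE _ Oy) _.
have dg y : O' y -> differentiable g y /\ forall v, 'd g y v = v *m invmx (J y).
  move=> O'y; have [Oy Ey] := gP y O'y.
  pose D := [the {linear 'rV[R]_n -> 'rV[R]_n} of mulmxr (invmx (J y))].
  have cD : continuous D by exact: row_linear_continuous.
  have [k k0 kD] := linear_lipschitz cD.
  suff [dgy Eg] : differentiable g y /\ 'd g y = D :> (_ -> _) by split => // v; rewrite Eg.
  apply: diff_eps => // e e0.
  pose e1 := e * c / k; have e10 : 0 < e1 by rewrite divr_gt0 // mulr_gt0.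
  have := diff_epsP (dE _ Oy) e10 => /nbhs_ballP[r /= r0 rP].
  near=> h.
  have O'h : O' (y + h).
    by near: h; exact: (@nbhs0_addl _ _ O' y (open_nbhs_nbhs (conj oO' O'y))).
  have hr : `|h| < c * r.
    near: h; apply/nbhs_ballP; exists (c * r) => /=; first exact: mulr_gt0.
    by move=> h; rewrite -ball_normE /= sub0r normrN.
  have [Oh Eh] := gP _ O'h.
  pose u := g (y + h) - g y.
  have ul : c * `|u| <= `|h| by have := glip _ _ O'h O'y; rewrite (addrC y h) addrK (addrC h y).
  have : ball 0 r u.
    by rewrite -ball_normE /= sub0r normrN -(ltr_pM2l c0); exact: le_lt_trans ul hr.
  have gu : g y + u = g (y + h) by rewrite /u addrC subrK.
  move=> /rP /=; rewrite gu Eh Ey (addrAC y) subrr add0r => hE.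
  have -> : g (y + h) - g y - D h = - D (h - 'd E (g y) u).
    by rewrite linearB opprB /= -JE mulmxK ?uJ.
  rewrite normrN; apply: le_trans (kD _) _.
  apply: le_trans (ler_wpM2l (ltW k0) hE) _.
  have -> : k * (e1 * `|u|) = e * (c * `|u|) by rewrite /e1; field; rewrite gt_eqF.
  by rewrite ler_wpM2l // ltW.
move=> k; elim: k => [|k IH].
  by move=> y O'y; apply: differentiable_continuous; have [] := dg y O'y.
split=> [y O'y|v]; first by have [] := dg y O'y.
have CJ i j : class_C k O' (fun y => J y i j).
  have C1 : class_C k O' (fun y => 'd E (g y) 'e_i).
    apply: (class_C_diff oO' oO (fun y O'y => (gP y O'y).1) IH _ (sE k.+1)).
    exact: class_C_cst.
  apply: class_C_ext oO' _ ((class_C_row _ _ oO').2 C1 j) => y _.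
  by rewrite -JE -rowE mxE.
have C2 : class_C k O' (fun y => v *m invmx (J y)).
  apply/class_C_row => // j.
  have C3 : class_C k O' (fun y => \sum_i v 0 i * invmx (J y) i j).
    apply: class_C_sum => // i _; apply: class_CM => //; first exact: class_C_cst.
    exact: invmx_class_C.
  by apply: class_C_ext oO' _ C3 => y _; rewrite mxE.
apply: class_C_ext oO' _ C2 => y; rewrite inE => O'y.
by have [_ ->] := dg y O'y.
Unshelve. all: by end_near. Qed.

End Inverse.

(** * Local flows in a vector space *)

Section LocalExponential.
Context {R : realType}.

Lemma row_fixed_point n (N : 'rV[R]_n -> 'rV[R]_n) (rho : R) : 0 <= rho ->
  (forall v, `|v| <= rho -> `|N v| <= rho) ->
  (forall v w, `|v| <= rho -> `|w| <= rho -> `|N v - N w| <= 1/2 * `|v - w|) ->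
  exists2 v, `|v| <= rho & N v = v.
Proof.
move=> rho0 Nrho lipN; pose u k := iter k N 0.
have ur k : `|u k| <= rho.
  by elim: k => [|k IH]; [rewrite normr0|exact: Nrho].
have [|v vP] := @geometric_limit_row _ _ u `|N 0|.
  elim=> [|k IH]; first by rewrite /= subr0 expr0 mulr1.
  apply: le_trans (lipN (u k.+1) (u k) (ur k.+1) (ur k)) _.
  by rewrite exprS mulrCA ler_wpM2l //; lra.
have vr : `|v| <= rho.
  apply/ler_addgt0Pl => e e0; have [k kP] := half_pow_small (2 * `|N 0|) e0.
  have h := ler_normB (u k) (u k - v); rewrite subKr in h.
  by have := ur k; have := vP k; lra.
exists v => //; apply/eqP; rewrite -subr_eq0 -normr_le0; apply/ler_addgt0Pl => e e0.
have e2 : 0 < e / 2 by lra.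
have [k kP] := half_pow_small (2 * `|N 0|) e2; rewrite addr0.
have h1 := lipN _ _ (ur k) vr; have h2 := vP k; have h3 := vP k.+1.
have h4 : 2 * `|N 0| * (1/2) ^+ k.+1 = (2 * `|N 0| * (1/2) ^+ k) / 2 by rewrite exprS; field.
have -> : N v - v = (u k.+1 - v) - (N (u k) - N v).
  by rewrite -[u k.+1]/(N (u k)); apply/rowP => i; rewrite !mxE; ring.
by have := ler_normB (u k.+1 - v) (N (u k) - N v); lra.
Qed.

Definition clamp_box n (z0 : 'rV[R]_n) (r : R) (z : 'rV[R]_n) : 'rV[R]_n :=
  \row_i clamp (z0 0 i - r) (z0 0 i + r) (z 0 i).

Lemma clamp_box_in n (z0 : 'rV[R]_n) r z : 0 <= r -> `|clamp_box z0 r z - z0| <= r.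
Proof.
move=> r0; apply: row_norm_le => // i; rewrite !mxE ler_norml.
have /andP[h1 h2] := @clamp_in _ (z0 0 i - r) (z0 0 i + r) (z 0 i) ltac:(lra).
by apply/andP; split; lra.
Qed.

Lemma clamp_box_id n (z0 : 'rV[R]_n) r z : `|z - z0| <= r -> clamp_box z0 r z = z.
Proof.
move=> zr; apply/rowP => i; rewrite mxE; apply: clamp_id.
have := le_trans (row_coord_le (z - z0) i) zr; rewrite !mxE ler_norml => /andP[h1 h2].
by apply/andP; split; lra.
Qed.

Lemma clamp_box_lipschitz n (z0 : 'rV[R]_n) r y z :
  `|clamp_box z0 r y - clamp_box z0 r z| <= `|y - z|.
Proof.
apply: row_norm_le => // i; rewrite !mxE; apply: le_trans (clamp_lipschitz _ _ _ _) _.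
by have := row_coord_le (y - z) i; rewrite !mxE.
Qed.

Lemma lipschitz_continuous (V W : normedModType R) (f : V -> W) (L : R) : 0 <= L ->
  (forall x y, `|f x - f y| <= L * `|x - y|) -> continuous f.
Proof.
move=> L0 fL x; apply/cvgrPdist_lt => e e0; have L1 : 0 < L + 1 by lra.
apply/nbhs_ballP; exists (e / (L + 1)) => /=; first by rewrite divr_gt0.
move=> y; rewrite -ball_normE /= ltr_pdivlMr // => xy.
apply: le_lt_trans (fL x y) _; have := normr_ge0 (x - y); nra.
Qed.

Lemma open_norm_lt n (z0 : 'rV[R]_n) (r : R) : open [set z | `|z - z0| < r].
Proof.
have -> : [set z | `|z - z0| < r] = ball z0 r.
  by apply/seteqP; split => z /=; rewrite -ball_normE /= distrC.
exact: ball_open.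
Qed.

Lemma compact_closed_ball n (z0 : 'rV[R]_n) (r : R) : compact [set z | `|z - z0| <= r].
Proof.
apply: bounded_closed_compact.
  exists (`|z0| + r); split; first exact: num_real.
  move=> x Mx z /= zr; apply: ltW; apply: le_lt_trans Mx.
  by have := ler_normD (z - z0) z0; rewrite subrK; lra.
rewrite -[X in closed X]/((fun z : 'rV[R]_n => `|z - z0|) @^-1` [set x | x <= r]).
apply: closed_comp; last exact: closed_le.
move=> z _; apply: (lipschitz_continuous ler01) => x y.
rewrite mul1r; apply: le_trans (ler_dist_dist _ _) _.
by rewrite opprB addrA subrK.
Qed.

Lemma convex_closed_ball n (z0 : 'rV[R]_n) (r : R) : convex [set z | `|z - z0| <= r].
Proof.
move=> x y t /= xr yr /andP[t0 t1].
have -> : x + t *: (y - x) - z0 = (1 - t) *: (x - z0) + t *: (y - z0).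
  by apply/rowP => i; rewrite !mxE; ring.
have t1' : 0 <= 1 - t by lra.
apply: le_trans (ler_normD _ _) _; rewrite !normrZ !ger0_norm //.
by have := ler_wpM2l t0 yr; have := ler_wpM2l t1' xr; lra.
Qed.

Lemma smooth_lipschitz_ball n m (O : set 'rV[R]_n) (X : 'rV[R]_n -> 'rV[R]_m) (z0 : 'rV[R]_n) (r : R) :
  smooth_on O X -> (forall z, `|z - z0| <= r -> O z) ->
  exists2 L : R, 0 <= L & forall y z, `|y - z0| <= r -> `|z - z0| <= r ->
    `|X y - X z| <= L * `|y - z|.
Proof.
move=> sX rO.
have [L L0 LP] := diff_bound (@compact_closed_ball n z0 r) rO (sX 1).
exists L => // y z yr zr.
exact: (lipschitz_convex (@convex_closed_ball n z0 r) (fun x xr => (sX 1).1 x (rO x xr)) LP).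
Qed.

(** Solutions through all nearby points, defined for a common time. The field is
   made globally Lipschitz by precomposing with the retraction onto a box, on
   which nothing changes; sup norms make this retraction 1-Lipschitz. *)
Lemma local_flow n (O : set 'rV[R]_n) (X : 'rV[R]_n -> 'rV[R]_n) (z0 : 'rV[R]_n) (r : R) :
  open O -> smooth_on O X -> 0 < r -> (forall z, `|z - z0| <= r -> O z) ->
  exists phi : R -> 'rV[R]_n -> 'rV[R]_n, exists L M T : R,
  [/\ 0 <= L, 0 <= M & 0 < T] /\
  [/\ forall p, phi 0 p = p,
      forall z, `|z - z0| <= r -> `|X z| <= M,
      forall y z, `|y - z0| <= r -> `|z - z0| <= r -> `|X y - X z| <= L * `|y - z|,
      forall t p, `|t| <= T -> `|p - z0| < r / 2 -> `|phi t p - z0| < r &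
      forall (t : R) p, `|t| <= T -> `|p - z0| < r / 2 ->
        is_derive t 1 (phi ^~ p) (X (phi t p))].
Proof.
move=> oO sX r0 rO; pose K := [set z : 'rV[R]_n | `|z - z0| <= r].
have cK : compact K by exact: compact_closed_ball.
have KO : K `<=` O by move=> z; exact: rO.
have [L L0 lipX] := smooth_lipschitz_ball sX rO.
have [M M0 MP] := compact_bound cK (fun z Kz => sX 0 z (KO z Kz)).
pose Y z := X (clamp_box z0 r z).
have Kc z : K (clamp_box z0 r z) by apply: clamp_box_in; exact: ltW.
have lipY y z : `|Y y - Y z| <= L * `|y - z|.
  by apply: le_trans (lipX _ _ (Kc y) (Kc z)) _; rewrite ler_wpM2l // clamp_box_lipschitz.
have cY := lipschitz_continuous L0 lipY.
have /choice[sol solP] : forall p, exists y : R -> 'rV[R]_n,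
    y 0 = p /\ forall t : R, is_derive t 1 y (Y (y t)).
  move=> p; apply: (@global_solution _ _ (fun _ => Y) L M) => //.
    move=> y cy t; exact: (continuous_comp (cy t) (cY (y t))).
  by move=> _; apply: MP.
pose T := r / (4 * (M + 1)); have T0 : 0 < T by rewrite divr_gt0 //; lra.
have TM : M * T <= r / 4.
  rewrite /T mulrA ler_pdivrMr; last lra.
  by nra.
have near_p t p : `|t| <= T -> `|sol p t - p| <= r / 4.
  move=> tT; have [s0 ds] := solP p.
  have bound (u v : R) : u <= v -> v - u <= T -> `|sol p v - sol p u| <= r / 4.
    move=> uv vuT; apply: le_trans TM; apply: (@le_trans _ _ ((v - u) * M)).
      by apply: (mean_value_const uv) => // s _; apply: MP.
    by rewrite mulrC ler_wpM2l.
  have [t0|t0] := leP 0 t.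
    by rewrite -[X in _ - X]s0; apply: bound => //; rewrite subr0 -(ger0_norm t0).
  by rewrite distrC -[X in X - _]s0; apply: bound; [exact: ltW|rewrite sub0r -(ltr0_norm t0)].
have in_K t p : `|t| <= T -> `|p - z0| < r / 2 -> `|sol p t - z0| < r.
  move=> tT pr; have := near_p t p tT; have := ler_normD (sol p t - p) (p - z0).
  by rewrite addrA subrK; lra.
exists (fun t p => sol p t), L, M, T; split => //; split => //.
  by move=> p; exact: (solP p).1.
move=> t p tT pr; have := (solP p).2 t; rewrite /Y clamp_box_id //.
exact/ltW/in_K.
Qed.

Lemma is_derive1_lsubmx n m (y : R -> 'rV[R]_(n + m)) (t : R) d :
  is_derive t 1 y d -> is_derive t 1 (fun s => lsubmx (y s)) (lsubmx d).
Proof.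
move=> /is_derive1_row dy; apply/is_derive1_row => i; rewrite mxE.
by have -> : (fun s => lsubmx (y s) 0 i) = fun s => y s 0 (lshift m i) by apply/funext => s; rewrite mxE.
Qed.

Lemma is_derive1_rsubmx n m (y : R -> 'rV[R]_(n + m)) (t : R) d :
  is_derive t 1 y d -> is_derive t 1 (fun s => rsubmx (y s)) (rsubmx d).
Proof.
move=> /is_derive1_row dy; apply/is_derive1_row => i; rewrite mxE.
by have -> : (fun s => rsubmx (y s) 0 i) = fun s => y s 0 (rshift n i) by apply/funext => s; rewrite mxE.
Qed.

End LocalExponential.

(** * The exponential map of a second-order equation in a vector space *)

Section SecondOrder.
Context {R : realType}.

Definition second_order n (F : 'rV[R]_(n + n) -> 'rV[R]_n) (z : 'rV[R]_(n + n)) : 'rV[R]_(n + n) :=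
  row_mx (rsubmx z) (F z).

Lemma second_order_smooth n (Om : set 'rV[R]_n) (F : 'rV[R]_(n + n) -> 'rV[R]_n) : open Om ->
  smooth_on ((lsubmx : 'rV[R]_(n + n) -> 'rV[R]_n) @^-1` Om) F ->
  smooth_on ((lsubmx : 'rV[R]_(n + n) -> 'rV[R]_n) @^-1` Om) (second_order F).
Proof.
move=> oOm sF k; apply: class_C_row_mx => //; first exact: open_lsubmx.
exact: class_C_rsubmx.
Qed.

Lemma small_time (a b c : R) : 0 <= a -> 0 <= b -> 0 <= c ->
  exists h, [/\ 0 < h, h <= 1 & [/\ h * a <= 1, h * b <= 1 & h * c <= 1]].
Proof.
move=> a0 b0 c0; exists (1 + a + b + c)^-1.
have S0 : 0 < 1 + a + b + c by lra.
by split; rewrite ?invr_gt0 // ?invf_le1 //; [lra|split; rewrite mulrC ler_pdivrMr //; lra].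
Qed.

(** For a short time h the position at time h is x + h v up to an error whose
   Lipschitz constant in the initial state is a small multiple of h. Hence the map
   from the initial state to the two endpoints expands distances by a multiple
   of h, and its last component, divided by h, is a small perturbation of the
   identity in v, so that nearby endpoints are reached. *)
Lemma local_exponential n (Om : set 'rV[R]_n) (F : 'rV[R]_(n + n) -> 'rV[R]_n) (x0 : 'rV[R]_n) :
  open Om -> Om x0 -> smooth_on ((lsubmx : 'rV[R]_(n + n) -> 'rV[R]_n) @^-1` Om) F ->
  exists (phi : R -> 'rV[R]_(n + n) -> 'rV[R]_(n + n)) (r rho delta h c : R),
  let z0 := row_mx x0 0 in
  [/\ 0 < r, 0 < h, 0 < c, 0 < delta & delta <= rho <= r] /\
  [/\ forall z : 'rV[R]_(n + n), `|z - z0| <= r -> Om (lsubmx z),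
      forall p, phi 0 p = p,
      forall t p, `|t| <= 2 * h -> `|p - z0| < rho -> `|phi t p - z0| < r &
      forall (t : R) p, `|t| <= 2 * h -> `|p - z0| < rho ->
        is_derive t 1 (phi ^~ p) (second_order F (phi t p))] /\
  [/\ smooth_on [set p | `|p - z0| < rho] (phi h),
      forall p q, `|p - z0| < rho -> `|q - z0| < rho ->
        c * `|p - q| <= `|row_mx (lsubmx p) (lsubmx (phi h p)) - row_mx (lsubmx q) (lsubmx (phi h q))| &
      forall x x', `|x - x0| < delta -> `|x' - x0| < delta ->
        exists v, `|row_mx x v - z0| < rho /\ lsubmx (phi h (row_mx x v)) = x'].
Proof.
move=> oOm Omx0 sF; set z0 := row_mx x0 0.
have [r r0 rOm] : exists2 r : R, 0 < r & forall z : 'rV[R]_(n + n), `|z - z0| <= r -> Om (lsubmx z).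
  have /nbhs_ballP[e /= e0 eP] : nbhs x0 Om by exact: open_nbhs_nbhs.
  exists (e / 2); first lra.
  move=> z ze; apply: eP; rewrite -ball_normE /= distrC.
  have := lsubmx_norm (z - z0); rewrite linearB /= /z0 row_mxKl; lra.
have oO := open_lsubmx (m := n) oOm.
pose X := second_order F.
have sX := second_order_smooth oOm sF.
have [phi [L [M [T [[L0 M0 T0] [phi0 XM lipX phir dphi]]]]]] := local_flow oO sX r0 rOm.
pose rho := r / 2; have rho0 : 0 < rho by rewrite /rho; lra.
pose G := gronwall_const L T; have G0 : 0 <= G by exact: gronwall_const_ge0.
have LG0 : 0 <= 4 * (L * G) by rewrite !mulr_ge0.
have [|||h [h0 h1 [hT hLG hM]]] := @small_time (2 / T) (4 * (L * G)) (8 * M / rho) => //.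
- by rewrite divr_ge0 // ltW.
- by rewrite divr_ge0 ?mulr_ge0 // ltW.
have {}hT : 2 * h <= T by move: hT; rewrite mulrA ler_pdivrMr //; lra.
have {}hM : h * M <= rho / 8 by move: hM; rewrite mulrA ler_pdivrMr //; lra.
have tT t : 0 <= t <= h -> `|t| <= T by case/andP=> t0 th; rewrite ger0_norm //; lra.
have hh : 0 <= h <= h by rewrite lexx ltW.
have dist t p q : 0 <= t <= h -> `|p - z0| < rho -> `|q - z0| < rho ->
    `|phi t p - phi t q| <= G * `|p - q|.
  move=> th pr qr; have := @gronwall _ _ (phi ^~ p - phi ^~ q)
    (fun s => X (phi s p) - X (phi s q)) L h 0 L0 (lexx 0) _ _ t th.
  rewrite !fctE !phi0 addr0 => H; apply: le_trans (H _ _) _.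
  - by move=> s sh; apply: is_deriveB; apply: dphi => //; exact: tT.
  - by move=> s sh; rewrite addr0; apply: lipX; apply: ltW; apply: phir => //; exact: tT.
  rewrite ler_wpM2r // /G /gronwall_const ler_wpM2l // ler_expR ler_wpM2l //; last by lra.
  by rewrite mulr_ge0 //; lra.
(* the velocities of two solutions differ from the initial difference by at most
   |p - q| / 4 up to time h; integrate once more *)
have key p q : `|p - z0| < rho -> `|q - z0| < rho ->
    `|lsubmx (phi h p) - lsubmx (phi h q) - lsubmx (p - q) - h *: rsubmx (p - q)|
    <= h / 4 * `|p - q|.
  move=> pr qr; set D := `|p - q|; have D0 : 0 <= D by exact: normr_ge0.
  pose u t := rsubmx (phi t p) - rsubmx (phi t q).
  pose y t := lsubmx (phi t p) - lsubmx (phi t q) - t *: rsubmx (p - q).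
  have du t : 0 <= t <= h -> `|u t - rsubmx (p - q)| <= D / 4.
    move=> /[dup] th /andP[t0 th'].
    have -> : rsubmx (p - q) = u 0 by rewrite /u !phi0 linearB.
    have := @mean_value_const _ _ u (fun s => rsubmx (X (phi s p)) - rsubmx (X (phi s q))) (L * (G * D)) 0 t t0.
    rewrite subr0 => H; apply: le_trans (H _ _) _.
    - move=> s /andP[s0 st]; have sh : 0 <= s <= h by rewrite s0 (le_trans st).
      by apply: is_deriveB; apply: is_derive1_rsubmx; apply: dphi => //; exact: tT.
    - move=> s /andP[s0 st]; have sh : 0 <= s <= h by rewrite s0 (le_trans st).
      rewrite -linearB; apply: le_trans (rsubmx_norm _) _.
      apply: le_trans (lipX _ _ _ _) _; try by apply: ltW; apply: phir => //; exact: tT.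
      by rewrite ler_wpM2l //; exact: dist.
    have LGD : 0 <= L * (G * D) by rewrite !mulr_ge0.
    have : t * (L * (G * D)) <= h * (L * (G * D)) by rewrite ler_wpM2r.
    have : h * (4 * (L * G)) * D <= 1 * D by rewrite ler_wpM2r.
    lra.
  have -> : lsubmx (phi h p) - lsubmx (phi h q) - lsubmx (p - q) - h *: rsubmx (p - q) = y h - y 0.
    rewrite /y !phi0 scale0r subr0; apply/rowP => i; rewrite !mxE; lra.
  have := @mean_value_const _ _ y (fun s => u s - rsubmx (p - q)) (D / 4) 0 h (ltW h0).
  rewrite [h - 0]subr0 => H; apply: le_trans (H _ _) _; [|exact: du|by lra].
  move=> t th; apply: is_deriveB.
    have dl s : `|s - z0| < rho -> is_derive t 1 (fun t => lsubmx (phi t s)) (rsubmx (phi t s)).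
      move=> sr; have -> : rsubmx (phi t s) = lsubmx (X (phi t s)) by rewrite row_mxKl.
      by apply: is_derive1_lsubmx; apply: dphi => //; exact: tT.
    by apply: is_deriveB; exact: dl.
  exact: is_derive1_scalel.
(* endpoints within delta = h rho / 16 of x0 ask for velocities of size at most
   2 delta / h = rho / 8, well inside the ball where solutions are controlled *)
exists phi, r, rho, (h * rho / 16), h, (h / 4) => /=.
split; first split => //.
- by rewrite divr_gt0.
- by rewrite divr_gt0 // mulr_gt0.
- by apply/andP; split; [nra|rewrite /rho; lra].
split; first split => //.
- by move=> t p th pr; apply: phir => //; exact: le_trans hT.
- by move=> t p th pr; apply: dphi => //; exact: le_trans hT.
have oB : open [set p : 'rV[R]_(n + n) | `|p - z0| < rho] := @open_norm_lt R _ z0 rho.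
split.
- move=> k.
  have cK := @compact_closed_ball R _ (z0 : 'rV[R]_(n + n)) r.
  have cvK := @convex_closed_ball R _ (z0 : 'rV[R]_(n + n)) r.
  apply: (@solution_class_C R k _ _ _ _ _ X phi h oO oB cK cvK _ sX (ltW h0)) => //.
  + by move=> t p th pr; apply: ltW; apply: phir => //; exact: tT.
  + by move=> t p th pr; apply: dphi => //; exact: tT.
  + move=> j; have -> : phi 0 = idfun by apply/funext => p; rewrite phi0.
    by apply: class_C_linear => p; exact: cvg_id.
- move=> p q pr qr; have := key p q pr qr.
  set a := lsubmx (p - q); set b := rsubmx (p - q); set D := lsubmx (phi h p) - _.
  set e := `|row_mx _ _ - _|.
  have ea : `|a| <= e.
    by have := lsubmx_norm (row_mx (lsubmx p) (lsubmx (phi h p)) - row_mx (lsubmx q) (lsubmx (phi h q)));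
      rewrite linearB /= !row_mxKl -linearB.
  have eD : `|D| <= e.
    by have := rsubmx_norm (row_mx (lsubmx p) (lsubmx (phi h p)) - row_mx (lsubmx q) (lsubmx (phi h q)));
      rewrite linearB /= !row_mxKr.
  have pq : `|p - q| <= `|a| + `|b|.
    by rewrite -[p - q]hsubmxK; apply: row_mx_norm_le; rewrite ?lerDl ?lerDr normr_ge0.
  move=> K.
  have hb : h * `|b| <= `|D| + `|a| + h / 4 * `|p - q|.
    have -> : h * `|b| = `|h *: b| by rewrite normrZ gtr0_norm.
    have -> : h *: b = D - a - (D - a - h *: b) by rewrite opprB addrC subrK.
    have := ler_normB (D - a) (D - a - h *: b); have := ler_normB D a; lra.
  have := normr_ge0 a; have := normr_ge0 b.
  have : h * `|a| <= `|a| by rewrite ler_piMl.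
  have : h / 4 * `|p - q| <= h / 4 * (`|a| + `|b|) by rewrite ler_wpM2l // divr_ge0 // ltW.
  lra.
move=> x x' xd x'd.
have delta_rho : h * rho / 16 <= rho / 16 by nra.
have inB v : `|v| <= rho / 2 -> `|row_mx x v - z0| < rho.
  move=> vr; have : `|row_mx x v - z0| <= rho / 2.
    rewrite /z0 opp_row_mx add_row_mx subr0; apply: row_mx_norm_le => //; lra.
  by lra.
(* a fixed point of N is an initial velocity from which x' is reached *)
pose N v := v + h^-1 *: (x' - lsubmx (phi h (row_mx x v))).
have hV : h * h^-1 = 1 by rewrite mulfV // gt_eqF.
have lipN v w : `|v| <= rho / 2 -> `|w| <= rho / 2 -> `|N v - N w| <= 1/4 * `|v - w|.
  move=> vr wr; have := key _ _ (inB v vr) (inB w wr).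
  rewrite opp_row_mx add_row_mx subrr row_mxKl row_mxKr subr0.
  have -> : `|row_mx (0 : 'rV[R]_n) (v - w)| = `|v - w| :> R.
    apply: le_anti; apply/andP; split; first by apply: row_mx_norm_le; rewrite ?normr0.
    by have := rsubmx_norm (row_mx (0 : 'rV[R]_n) (v - w)); rewrite row_mxKr.
  move=> K; rewrite -(ler_pM2l h0).
  have -> : h * `|N v - N w| = `|h *: (N v - N w)| by rewrite normrZ gtr0_norm.
  have -> : h *: (N v - N w) = - (lsubmx (phi h (row_mx x v)) - lsubmx (phi h (row_mx x w)) - h *: (v - w)).
    rewrite /N !(scalerDr, scalerN, scalerA) !hV !scale1r.
    by apply/rowP => i; rewrite !mxE; ring.
  by rewrite normrN; lra.
have N0 : `|N 0| <= rho / 4.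
  rewrite /N add0r -(ler_pM2l h0) normrZ gtr0_norm ?invr_gt0 // mulrA hV mul1r.
  have x0r : `|row_mx x 0 - z0| < rho by apply: inB; rewrite normr0; lra.
  pose p := row_mx x (0 : 'rV[R]_n).
  have v_small t : 0 <= t <= h -> `|rsubmx (phi t p)| <= rho / 8.
    move=> /[dup] th /andP[t0 th'].
    have := @mean_value_const _ _ (fun s => rsubmx (phi s p)) (fun s => rsubmx (X (phi s p))) M 0 t t0.
    rewrite phi0 /p row_mxKr !subr0 => H; apply: le_trans (H _ _) _.
    - move=> s /andP[s0 st]; have sh : 0 <= s <= h by rewrite s0 (le_trans st).
      by apply: is_derive1_rsubmx; apply: dphi => //; exact: tT.
    - move=> s /andP[s0 st]; have sh : 0 <= s <= h by rewrite s0 (le_trans st).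
      apply: le_trans (rsubmx_norm _) _; apply: XM; apply: ltW; apply: phir => //; exact: tT.
    by apply: le_trans hM; rewrite ler_wpM2r.
  have xs : `|lsubmx (phi h p) - x| <= h * (rho / 8).
    have := @mean_value_const _ _ (fun s => lsubmx (phi s p)) (fun s => lsubmx (X (phi s p))) (rho / 8) 0 h (ltW h0).
    rewrite subr0 phi0 {2}/p row_mxKl => H; apply: H.
    - by move=> s sh; apply: is_derive1_lsubmx; apply: dphi => //; exact: tT.
    - by move=> s sh; rewrite row_mxKl; exact: v_small.
  have -> : x' - lsubmx (phi h p) = (x' - x0) - (x - x0) - (lsubmx (phi h p) - x).
    by apply/rowP => i; rewrite !mxE; ring.
  have := ler_normB ((x' - x0) - (x - x0)) (lsubmx (phi h p) - x).
  have := ler_normB (x' - x0) (x - x0); lra.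
have [||v w vr wr|v vr Nv] := @row_fixed_point _ _ N (rho / 2).
- by lra.
- move=> v vr; have := lipN v 0 vr ltac:(rewrite normr0; lra).
  have := ler_normD (N v - N 0) (N 0); rewrite subrK subr0; lra.
- by apply: le_trans (lipN _ _ vr wr) _; have := normr_ge0 (v - w); lra.
exists v; split; first exact: inB.
have : h *: (N v - v) = 0 by rewrite Nv subrr scaler0.
by rewrite /N addrC addKr scalerA hV scale1r => /eqP; rewrite subr_eq0 => /eqP.
Qed.

End SecondOrder.

(** * Charts, products and tangent bundles *)

Section ChartTopology.
Context {R : realType}.

(** The part of the definition of a manifold that passes to products and tangent
   bundles chart by chart. *)
Record smooth_atlas (M : atlas R) : Prop := SmoothAtlas {
  atlas_chart_atP : forall q : M, dom (chart_at q) q ;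
  atlas_coordK : forall (a : chart M) (q : M), dom a q -> param a (coords a q) = q ;
  atlas_overlap_open : forall a b : chart M, open (coords a @` (dom a `&` dom b)) ;
  atlas_overlap_smooth : forall a b : chart M,
    smooth_on (coords a @` (dom a `&` dom b)) (coords b \o param a) }.

Arguments atlas_overlap_smooth {M} _ a b _.
Arguments atlas_overlap_open {M} _ a b.

Variable M : atlas R.
Hypothesis Mok : smooth_atlas M.

Lemma open_chart (a : chart M) (O : set 'rV[R]_(dimension M)) : open O ->
  open (dom a `&` coords a @^-1` O : set M).
Proof.
move=> oO; set W := (X in open X).
have sW : @chart_subbase R M W by exists a, O.
exists [set W]; last by rewrite bigcup_set1.
move=> _ ->; exists (finmap.fset1 W); last by rewrite set_fset1 bigcap_set1.
by move=> V; rewrite finmap.in_fset1 => /eqP ->; exact: mem_set.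
Qed.

(** The chart neighbourhoods are only a subbase, but finite intersections are
   harmless for continuity. *)
Lemma continuous_into_atlas (T : topologicalType) (f : T -> M) x :
  (forall (a : chart M) (O : set 'rV[R]_(dimension M)), open O -> dom a (f x) -> O (coords a (f x)) ->
    nbhs x (f @^-1` (dom a `&` coords a @^-1` O))) -> {for x, continuous f}.
Proof.
move=> fP A [_ [[I IP <-] [V IV Vfx] VA]].
apply: (@filterS _ _ _ (f @^-1` V)).
  by move=> y Vy; apply: VA; exists V.
have [J JP VE] := IP _ IV; rewrite -VE in Vfx *.
rewrite preimage_bigcap; apply: filter_bigI => W WF.
have [a [A0 [oO EW]]] : chart_subbase W by exact: set_mem (JP W WF).
have [da Oa] : (dom a `&` coords a @^-1` A0) (f x) by rewrite -EW; exact: Vfx.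
by rewrite EW; exact: fP.
Qed.

Lemma coords_param (a : chart M) x : (coords a @` dom a) x ->
  dom a (param a x) /\ coords a (param a x) = x.
Proof. by move=> [q aq <-]; rewrite (atlas_coordK Mok). Qed.

Lemma open_coords (a : chart M) : open (coords a @` dom a).
Proof. by rewrite -[dom a]setIid; exact: atlas_overlap_open. Qed.

Lemma open_dom (a : chart M) : open (dom a : set M).
Proof. by rewrite -[dom a]setIT -(preimage_setT (coords a)); apply: open_chart; exact: openT. Qed.

Lemma continuous_coords (a : chart M) q : dom a q -> {for q, continuous (coords a)}.
Proof.
move=> aq A; rewrite nbhsE => -[A0 [oO Oq] OA].
have : nbhs q (dom a `&` coords a @^-1` A0 : set M).
  by apply: open_nbhs_nbhs; split; [exact: open_chart|split].
by apply: filterS => p [_ /OA].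
Qed.

Lemma param_overlap (a b : chart M) x : (coords a @` (dom a `&` dom b)) x ->
  [/\ (coords a @` dom a) x, dom a (param a x), dom b (param a x) & coords a (param a x) = x].
Proof. by move=> [q [aq bq] <-]; rewrite (atlas_coordK Mok) //; split => //; exists q. Qed.

Lemma overlapP (a b : chart M) x : (coords a @` dom a) x -> dom b (param a x) ->
  (coords a @` (dom a `&` dom b)) x.
Proof. by move=> /coords_param[ax E] bx; exists (param a x). Qed.

Lemma continuous_param (a : chart M) x : (coords a @` dom a) x -> {for x, continuous (param a)}.
Proof.
move=> ax; apply: continuous_into_atlas => b O oO bx Ox.
have oab := atlas_overlap_open Mok a b.
have oS : open (coords a @` (dom a `&` dom b) `&` (coords b \o param a) @^-1` O).
  apply: (open_sub_preimage oab oO) => y aby.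
  exact: (atlas_overlap_smooth Mok a b 0).
have : nbhs x (coords a @` (dom a `&` dom b) `&` (coords b \o param a) @^-1` O).
  by apply: open_nbhs_nbhs; split => //; split => //; exact: overlapP.
by apply: filterS => y [/param_overlap[_ _ bay _] Oy]; split.
Qed.

Lemma open_in_chart (a : chart M) (W : set M) : W `<=` dom a -> open W -> open (coords a @` W).
Proof.
move=> Wa oW.
have -> : coords a @` W = coords a @` dom a `&` param a @^-1` W.
  apply/seteqP; split => [_ [q Wq <-]|x [ax Wx]].
    by split; [exists q => //; exact: Wa|rewrite /= (atlas_coordK Mok) //; exact: Wa].
  by exists (param a x) => //; have [] := coords_param ax.
apply: open_sub_preimage => //; first exact: open_coords.
exact: continuous_param.
Qed.

End ChartTopology.

Arguments atlas_overlap_smooth {R M} _ a b _.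
Arguments atlas_overlap_open {R M} _ a b.

Section SmoothMaps.
Context {R : realType}.

(** A map is smooth as soon as it is smooth in one pair of charts that contain its
   domain and its image: the other coordinate expressions differ from this one
   by changes of coordinates. *)
Lemma smooth_map_of_chart (M N : atlas R) (W : set M) (f : M -> N) (a0 : chart M) (b0 : chart N)
    (F : 'rV[R]_(dimension M) -> 'rV[R]_(dimension N)) :
  smooth_atlas M -> smooth_atlas N -> open W -> W `<=` dom a0 ->
  smooth_on (coords a0 @` W) F ->
  (forall p, W p -> dom b0 (f p) /\ coords b0 (f p) = F (coords a0 p)) ->
  smooth_map W f.
Proof.
move=> Mok Nok oW Wa sF fP.
have oO := open_in_chart Mok Wa oW; set O := coords a0 @` W in sF oO *.
have cf p : W p -> {for p, continuous f}.
  move=> Wp; have [bp Fp] := fP p Wp.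
  have c1 : {for p, continuous (param b0 \o (F \o coords a0))}.
    apply: continuous_comp; last first.
      by apply: continuous_param => //; rewrite /= -Fp; exists (f p).
    apply: continuous_comp; first exact: continuous_coords (Wa _ Wp).
    by apply: (sF 0); exists p.
  move=> A fA; have : nbhs p ((param b0 \o (F \o coords a0)) @^-1` A).
    by apply: c1; rewrite /= -Fp (atlas_coordK Nok).
  have : nbhs p W by exact: open_nbhs_nbhs.
  apply: filterS2 => q Wq /=; have [bq <-] := fP q Wq.
  by rewrite (atlas_coordK Nok).
split=> // a b k.
pose tM := coords a0 \o param a; pose tN := coords b \o param b0.
pose S := coords a @` (dom a `&` dom a0) `&` tM @^-1` (O `&` F @^-1` (coords b0 @` (dom b0 `&` dom b))).
have oab := atlas_overlap_open Mok a a0; have ob := atlas_overlap_open Nok b0 b.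
have oS : open S.
  apply: (open_sub_preimage oab) => [|x ax]; last exact: (atlas_overlap_smooth Mok a a0 0).
  by apply: (open_sub_preimage oO ob) => x Ox; exact: (sF 0).
have SE : coords a @` (W `&` dom a `&` f @^-1` dom b) `<=` S.
  move=> _ [q [[Wq aq] bq] <-]; have [b0q Fq] := fP q Wq.
  split; first by exists q => //; split => //; exact: Wa.
  rewrite /= /tM /= (atlas_coordK Mok) //; split; first by exists q.
  by rewrite /= -Fq; exists (f q).
apply: class_C_subset SE _.
have C1 : class_C k S tM.
  by apply: class_C_subset (atlas_overlap_smooth Mok a a0 k) => x [].
have C2 : class_C k S (F \o tM).
  by apply: (class_C_comp_row oS oO _ C1 (sF k)) => x [_ []].
have C3 : class_C k S (tN \o (F \o tM)).
  by apply: (class_C_comp_row oS ob _ C2 (atlas_overlap_smooth Nok b0 b k)) => x [_ []].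
apply: class_C_ext oS _ C3 => x /set_mem[/(param_overlap Mok)[_ ax a0x Ex] [xO _]].
have Wx : W (param a x).
  case: xO => q Wq; rewrite /tM /= => E.
  by rewrite -(atlas_coordK Mok a0x) -E (atlas_coordK Mok (Wa _ Wq)).
have [bx Fx] := fP _ Wx.
by rewrite /tN /tM /= -Fx (atlas_coordK Nok).
Qed.

Lemma product_smooth_atlas (M N : atlas R) : smooth_atlas M -> smooth_atlas N ->
  smooth_atlas (product M N).
Proof.
move=> Mok Nok.
have ovE (a b : chart (product M N)) : coords a @` (dom a `&` dom b) =
    lsubmx @^-1` (coords a.1 @` (dom a.1 `&` dom b.1)) `&`
    rsubmx @^-1` (coords a.2 @` (dom a.2 `&` dom b.2)).
  apply/seteqP; split => [_ [q [[a1 a2] [b1 b2]] <-]|y [[p [p1 p2] Ep] [q [q1 q2] Eq]]].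
    by split; rewrite /= ?row_mxKl ?row_mxKr; [exists q.1|exists q.2].
  by exists (p, q) => //=; rewrite Ep Eq hsubmxK.
have ovo (a b : chart (product M N)) : open (coords a @` (dom a `&` dom b)).
  rewrite ovE; apply: openI; apply: open_comp => //; try exact: atlas_overlap_open.
  - by move=> z _; exact: lsubmx_continuous.
  - by move=> z _; exact: rsubmx_continuous.
split=> //.
- by move=> q; split; exact: atlas_chart_atP.
- move=> a [p q] [/= ap aq]; rewrite /= row_mxKl row_mxKr.
  by rewrite (atlas_coordK Mok) // (atlas_coordK Nok).
- move=> a b k.
  apply: (@class_C_row_mx _ _ _ _ _ _ (coords b.1 \o param a.1 \o lsubmx) (coords b.2 \o param a.2 \o rsubmx)) => //.
    apply: (class_C_comp_row (ovo a b) (atlas_overlap_open Mok a.1 b.1) _ (class_C_lsubmx _ _) (atlas_overlap_smooth Mok a.1 b.1 k)).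
    by move=> z; rewrite ovE => -[].
  apply: (class_C_comp_row (ovo a b) (atlas_overlap_open Nok a.2 b.2) _ (class_C_rsubmx _ _) (atlas_overlap_smooth Nok a.2 b.2 k)).
  by move=> z; rewrite ovE => -[].
Qed.

End SmoothMaps.

Section Tangent.
Context {R : realType}.
Variable M : atlas R.
Hypothesis Mok : smooth_atlas M.

Lemma trans_diff (a b : chart M) x : (coords a @` (dom a `&` dom b)) x ->
  differentiable (coords b \o param a) x.
Proof. exact: (atlas_overlap_smooth Mok a b 1).1. Qed.

(** The cocycle rule for the derivatives of the changes of coordinates, which is
   what makes the components of a tangent vector in a chart consistent. *)
Lemma trans_cocycle (a b c : chart M) x v : (coords a @` dom a) x ->
  dom b (param a x) -> dom c (param a x) ->
  'd (coords c \o param b) (coords b (param a x)) ('d (coords b \o param a) x v)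
  = 'd (coords c \o param a) x v.
Proof.
move=> ax bx cx; have [aax Ex] := coords_param Mok ax.
have abx := overlapP Mok ax bx; have acx := overlapP Mok ax cx.
have bcx : (coords b @` (dom b `&` dom c)) (coords b (param a x)).
  by exists (param a x).
have E1 := diff_comp (trans_diff abx) (trans_diff bcx).
apply: etrans (esym (congr1 (fun h => h v) E1)) _.
have oab := atlas_overlap_open Mok a b.
have [||_ E2] := @diff_ext _ _ _ _ ((coords c \o param b) \o (coords b \o param a)) (coords c \o param a) x oab _ abx.
- by move=> y /set_mem/(param_overlap Mok)[_ _ bay _] /=; rewrite (atlas_coordK Mok).
- exact: differentiable_comp (trans_diff abx) (trans_diff bcx).
exact: (esym (congr1 (fun h => h v) E2)).
Qed.

Lemma trans_id (a : chart M) x v : (coords a @` dom a) x -> 'd (coords a \o param a) x v = v.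
Proof.
move=> ax; have oa := open_coords Mok (a := a).
have [||_ E] := @diff_ext _ _ _ _ (@idfun 'rV[R]_(dimension M)) (coords a \o param a) x oa _ ax.
- by move=> y /set_mem/(coords_param Mok)[_ /=].
- exact: ex_diff.
apply: etrans (congr1 (fun h => h v) E) _.
by rewrite diff_val.
Qed.

Lemma tangent_coords_fst (a : chart M) (w : tangent M) :
  lsubmx (coords (a := tangent M) a w) = coords a w.1.
Proof. by rewrite /= row_mxKl. Qed.

Lemma tangent_coords_snd (a : chart M) (w : tangent M) :
  rsubmx (coords (a := tangent M) a w) = 'd (coords a \o param (chart_at w.1)) (coords (chart_at w.1) w.1) w.2.
Proof. by rewrite /= row_mxKr. Qed.

Lemma tangent_coordK (a : chart M) (w : tangent M) : dom a w.1 ->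
  param (a := tangent M) a (coords (a := tangent M) a w) = w.
Proof.
case: w => q v /= aq; rewrite row_mxKl row_mxKr (atlas_coordK Mok) //; congr (_, _).
set c := chart_at q; have cq : dom c q by exact: atlas_chart_atP.
have cx : (coords c @` dom c) (coords c q) by exists q.
have := @trans_cocycle c a c (coords c q) v cx; rewrite (atlas_coordK Mok) // => -> //.
exact: trans_id.
Qed.

Lemma tangent_paramK (a : chart M) (y : 'rV[R]_(dimension M + dimension M)) :
  (coords a @` dom a) (lsubmx y) ->
  coords (a := tangent M) a (param (a := tangent M) a y) = y.
Proof.
move=> ay; have [ady Ey] := coords_param Mok ay; rewrite -[RHS]hsubmxK /=; congr row_mx => //.
set c := chart_at _.
have cq : dom c (param a (lsubmx y)) by exact: atlas_chart_atP.
by rewrite (@trans_cocycle a c a) // trans_id.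
Qed.

Lemma tangent_overlapE (a b : chart M) :
  coords (a := tangent M) a @` (dom (a := tangent M) a `&` dom (a := tangent M) b) =
  lsubmx @^-1` (coords a @` (dom a `&` dom b)).
Proof.
apply/seteqP; split => [_ [w [aw bw] <-]|y aby]; first by exists w.1 => //=; rewrite row_mxKl.
have [ay ady bdy Ey] := param_overlap Mok aby.
by exists (param (a := tangent M) a y) => //; exact: tangent_paramK.
Qed.

Lemma tangent_domE (a : chart M) :
  coords (a := tangent M) a @` (dom (a := tangent M) a) = lsubmx @^-1` (coords a @` dom a).
Proof. by have := tangent_overlapE a a; rewrite !setIid. Qed.

Lemma tangent_transE (a b : chart M) y : (coords a @` (dom a `&` dom b)) (lsubmx y) ->
  coords (a := tangent M) b (param (a := tangent M) a y) =
  row_mx ((coords b \o param a) (lsubmx y)) ('d (coords b \o param a) (lsubmx y) (rsubmx y)).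
Proof.
move=> aby; have [ay ady bdy Ey] := param_overlap Mok aby.
rewrite /=; congr row_mx; apply: trans_cocycle => //; exact: atlas_chart_atP.
Qed.

Lemma tangent_smooth_atlas : smooth_atlas (tangent M).
Proof.
have ovo (a b : chart M) : open (coords (a := tangent M) a @` (dom (a := tangent M) a `&` dom (a := tangent M) b)).
  by rewrite tangent_overlapE; apply: open_lsubmx; exact: atlas_overlap_open.
split=> //.
- by move=> w; exact: (atlas_chart_atP Mok w.1).
- exact: tangent_coordK.
- change (forall a b : chart M, smooth_on (coords (a := tangent M) a @` (dom (a := tangent M) a `&` dom (a := tangent M) b)) (coords (a := tangent M) b \o param (a := tangent M) a)).
  move=> a b k; have oab := atlas_overlap_open Mok a b.
  have C1 : class_C k (coords (a := tangent M) a @` (dom (a := tangent M) a `&` dom (a := tangent M) b))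
      (fun y => row_mx ((coords b \o param a) (lsubmx y)) ('d (coords b \o param a) (lsubmx y) (rsubmx y))).
    apply: class_C_row_mx => //.
      apply: (class_C_comp_row (ovo a b) oab _ (class_C_lsubmx _ _) (atlas_overlap_smooth Mok a b k)).
      by rewrite tangent_overlapE.
    apply: (class_C_diff (ovo a b) oab _ (class_C_lsubmx _ _) (class_C_rsubmx _ _) (atlas_overlap_smooth Mok a b k.+1)).
    by rewrite tangent_overlapE.
  apply: class_C_ext (ovo a b) _ C1 => y /set_mem; rewrite tangent_overlapE => aby.
  exact/esym/tangent_transE.
Qed.

Lemma continuous_tau : continuous (@tau R M).
Proof.
move=> w; apply: continuous_into_atlas => a O oO aw Ow.
have oa : open ((lsubmx : 'rV[R]_(dimension M + dimension M) -> _) @^-1` O) by exact: open_lsubmx.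
have := @open_chart R (tangent M) a _ oa.
move=> oW; have : nbhs w (dom (a := tangent M) a `&` coords (a := tangent M) a @^-1` (lsubmx @^-1` O)).
  by apply: open_nbhs_nbhs; split => //; split => //=; rewrite row_mxKl.
by apply: filterS => u [au] /=; rewrite row_mxKl.
Qed.

Lemma cluster_continuous (T U : topologicalType) (f : T -> U) p q :
  {for p, continuous f} -> {for q, continuous f} ->
  cluster (nbhs p) q -> cluster (nbhs (f p)) (f q).
Proof.
move=> cp cq pq A B fA fB; have [x [Ax Bx]] := pq _ _ (cp _ fA) (cq _ fB).
by exists (f x).
Qed.

(** Vectors at different points are separated in the base, vectors at the same
   point in a common chart. *)
Lemma tangent_hausdorff : hausdorff_space M -> hausdorff_space (tangent M).
Proof.
move=> hM p q pq.
have E : p.1 = q.1 := hM _ _ (cluster_continuous (@continuous_tau p) (@continuous_tau q) pq).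
pose a : chart (tangent M) := chart_at p.1.
have ap : dom a p by exact: (atlas_chart_atP Mok p.1).
have aq : dom a q by rewrite /a /= -E; exact: (atlas_chart_atP Mok p.1).
have := cluster_continuous (continuous_coords ap) (continuous_coords aq) pq.
move=> /(@norm_hausdorff _ _) E2.
by rewrite -(tangent_coordK ap) -(tangent_coordK aq) E2.
Qed.

End Tangent.

(** * Velocities of curves *)

Section Velocity.
Context {R : realType}.

(** Without this the one-sided limit in the definition of the velocity would not
   be unique. *)
Lemma within_interval_proper (J : set R) (t1 t2 t : R) : is_interval J ->
  J t1 -> J t2 -> t1 != t2 -> J t -> ProperFilter (within J t^').
Proof.
move=> iJ Jt1 Jt2 t12 Jt.
have [u Ju ut] : exists2 u, J u & u != t.
  by have [E|] := eqVneq t1 t; [exists t2; rewrite // -E eq_sym|exists t1].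
apply: Build_ProperFilter_ex => A.
rewrite /within /= /dnbhs /within /= => /nbhs_ballP[e /= e0 eA].
have d0 : 0 < `|u - t| by rewrite normr_gt0 subr_eq0.
pose s := Num.min 1 (e / (2 * `|u - t|)).
have s0 : 0 < s by rewrite lt_min ltr01 divr_gt0 // mulr_gt0.
have s1 : s <= 1 by rewrite ge_min lexx.
have se : s * `|u - t| <= e / 2.
  have : s <= e / (2 * `|u - t|) by rewrite ge_min lexx orbT.
  by rewrite ler_pdivlMr ?mulr_gt0 //; lra.
exists (t + s * (u - t)); apply: eA.
- by rewrite -ball_normE /= opprD addrA subrr sub0r normrN normrM gtr0_norm //; lra.
- by rewrite -subr_eq0 addrC addKr; apply: mulf_neq0; [rewrite gt_eqF|rewrite subr_eq0].
have [ut'|tu] := leP u t.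
  apply: (iJ _ _ Ju Jt); apply/andP; split; nra.
apply: (iJ _ _ Jt Ju); apply/andP; split; nra.
Qed.

Lemma fmap_within_ext (T U : Type) (F : set_system T) (J : set T) (f1 f2 : T -> U) :
  (forall s, J s -> f1 s = f2 s) -> f1 @ within J F = f2 @ within J F.
Proof.
move=> f12; apply/funext => A; congr (F _); apply/funext => s; apply/propext.
by split=> h Js; have := h Js; rewrite /= f12.
Qed.

Lemma velocity_ext (M : atlas R) (J : set R) (c1 c2 : R -> M) t :
  (forall s, J s -> c1 s = c2 s) -> J t -> velocity J c1 t = velocity J c2 t.
Proof.
move=> c12 Jt; rewrite /velocity (c12 t Jt); congr (_, _); congr (lim _).
by apply: fmap_within_ext => s Js; rewrite (c12 s Js).
Qed.

Lemma integral_curve_ext (M : atlas R) (X : M -> tangent M) (J : set R) (c1 c2 : R -> M) :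
  (forall s, J s -> c1 s = c2 s) -> integral_curve X J c1 -> integral_curve X J c2.
Proof.
move=> c12 [[W [c' [oW JW cc' ccont csm]]] vc]; split.
  by exists W, c'; split=> // s Js; rewrite cc' // c12.
by move=> t Jt; rewrite -(velocity_ext c12 Jt) vc // c12.
Qed.

(** The velocity is a limit within J in the chart chosen at the point. It is read
   off from a two-sided derivative of an extension of the curve, and the cocycle
   rule carries it to any other chart. *)
Lemma velocity_coords (M : atlas R) (J : set R) (c c' : R -> M) (t : R) (a : chart M) d :
  smooth_atlas M -> J t -> ProperFilter (within J t^') ->
  (forall s, J s -> c' s = c s) -> {for t, continuous c'} -> dom a (c t) ->
  is_derive t 1 (coords a \o c') d ->
  coords (a := tangent M) a (velocity J c t) = row_mx (coords a (c t)) d.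
Proof.
move=> Mok Jt pJ cc' cc ac da; rewrite /=; congr row_mx.
set b := chart_at (c t); have bc : dom b (c t) by exact: atlas_chart_atP.
have ctE : c' t = c t by exact: cc'.
have ax : (coords a @` dom a) (coords a (c t)) by exists (c t).
have abx : (coords a @` (dom a `&` dom b)) (coords a (c t)) by exists (c t).
pose e := 'd (coords b \o param a) (coords a (c t)) d.
have de : is_derive t 1 (coords b \o c') e.
  have h : is_derive t 1 ((coords b \o param a) \o (coords a \o c')) e.
    have := @is_derive1_comp _ _ _ (coords a \o c') (coords b \o param a) t d da.
    by rewrite /= ctE; apply; exact: (trans_diff Mok abx).
  apply: near_eq_is_derive h.
  have : nbhs t (c' @^-1` dom a).
    by apply: cc; apply: open_nbhs_nbhs; split; [exact: open_dom|rewrite ctE].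
  by apply: filterS => s /= as_; rewrite (atlas_coordK Mok).
have -> : lim ((s - t)^-1 *: (coords b (c s) - coords b (c t)) @[s --> within J t^']) = e.
  apply: cvg_lim; first exact: norm_hausdorff.
  apply/cvgrPdist_le => eps eps0.
  have [dc ve] := (is_derive1_diff _ _ _).1 de.
  have := diff_epsP dc eps0; move=> /nbhs_ballP[r /= r0 rP].
  rewrite /within /= /dnbhs /within /=; apply/nbhs_ballP; exists r => //= s.
  rewrite -ball_normE /= => ts st Js.
  have st0 : s - t != 0 by rewrite subr_eq0.
  have nst : 0 < `|s - t| by rewrite normr_gt0.
  have /rP : ball (0 : R) r (s - t).
    by rewrite -ball_normE /= sub0r normrN distrC.
  have ts' : t + (s - t) = s by rewrite addrC subrK.
  rewrite /= ts' ctE (cc' s Js).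
  have -> : 'd (coords b \o c') t (s - t) = (s - t) *: e.
    by rewrite -ve -[s - t in LHS]mulr1; exact: linearZZ.
  move=> h; rewrite -(ler_pM2l nst) -normrZ scalerBr scalerA mulfV // scale1r distrC.
  by rewrite mulrC.
have := @trans_cocycle _ _ Mok a b a (coords a (c t)) d ax.
rewrite (atlas_coordK Mok) // => -> //.
exact: trans_id.
Qed.

Lemma smooth_curve_velocity (M : atlas R) (J : set R) (c c' : R -> M) (W : set R) (t : R) (a : chart M) :
  smooth_atlas M -> J t -> ProperFilter (within J t^') -> W t ->
  (forall s, J s -> c' s = c s) -> {for t, continuous c'} ->
  smooth_on (W `&` c' @^-1` dom a) (coords a \o c') -> dom a (c t) ->
  is_derive t 1 (coords a \o c') (rsubmx (coords (a := tangent M) a (velocity J c t))).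
Proof.
move=> Mok Jt pJ Wt cc' cc sc ac.
have dc : differentiable (coords a \o c') t by apply: (sc 1).1; split => //=; rewrite cc'.
have de : is_derive t 1 (coords a \o c') ('d (coords a \o c') t 1) by apply/is_derive1_diff.
by rewrite (velocity_coords Mok Jt pJ cc' cc ac de) row_mxKr.
Qed.

Lemma smooth_curve_of_chart (M : atlas R) (J W : set R) (a : chart M)
    (y : R -> 'rV[R]_(dimension M)) :
  smooth_atlas M -> open W -> J `<=` W -> smooth_on W y ->
  (forall t, W t -> (coords a @` dom a) (y t)) ->
  smooth_curve J (param a \o y).
Proof.
move=> Mok oW JW sy ya; exists W, (param a \o y); split=> //.
  move=> t Wt; apply: continuous_comp; first exact: (sy 0).
  exact: continuous_param (ya t Wt).
move=> b k; have oab := atlas_overlap_open Mok a b.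
have E : W `&` (param a \o y) @^-1` dom b = W `&` y @^-1` (coords a @` (dom a `&` dom b)).
  apply/seteqP; split => t [Wt] /= h; split => //=.
    by apply: (overlapP Mok) => //; exact: ya.
  by have [] := param_overlap Mok h.
have oS : open (W `&` y @^-1` (coords a @` (dom a `&` dom b))).
  by apply: (open_sub_preimage oW oab) => t Wt; exact: (sy 0).
rewrite E; apply: (class_C_comp_row oS oab _ _ (atlas_overlap_smooth Mok a b k)).
  by move=> t [].
by apply: class_C_subset (sy k) => t [].
Qed.

(** Each derivative of a solution is a smooth function of the solution, so
   regularity improves by one class at a time. *)
Lemma solution_smooth n (W : set R) (O : set 'rV[R]_n) (X : 'rV[R]_n -> 'rV[R]_n) (z : R -> 'rV[R]_n) :
  open W -> open O -> smooth_on O X -> (forall t, W t -> O (z t)) ->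
  (forall t : R, W t -> is_derive t 1 z (X (z t))) -> smooth_on W z.
Proof.
move=> oW oO sX zO dz; elim=> [|k IH].
  by move=> t Wt; exact: is_derive1_continuous (dz t Wt).
split=> [t Wt|v]; first by have /is_derive1_diff[] := dz t Wt.
apply/class_C_row => // i.
have C1 : class_C k W (fun t => v * X (z t) 0 i).
  apply: class_CM => //; first exact: class_C_cst.
  exact: (class_C_row _ _ oW).2 (class_C_comp_row oW oO zO IH (sX k)) i.
apply: class_C_ext oW _ C1 => t /set_mem Wt.
have /is_derive1_diff[_ E] := dz t Wt.
have -> : 'd z t v = v *: 'd z t 1 by rewrite -[v in LHS]mulr1; exact: linearZZ.
by rewrite E mxE.
Qed.

End Velocity.

(** * Second-order fields in a chart *)

Section Sode.
Context {R : realType}.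
Variable Q : atlas R.
Hypothesis Qok : smooth_atlas Q.
Variable Gamma : tangent Q -> tangent (tangent Q).
Hypothesis Gamma_sode : sode Gamma.

Let TQok : smooth_atlas (tangent Q) := tangent_smooth_atlas Qok.

(** The components of the field at z are z followed by those of a tangent vector,
   which are in turn the velocity followed by the acceleration. *)
Definition sode_force (a : chart Q) (z : 'rV[R]_(dimension Q + dimension Q)) : 'rV[R]_(dimension Q) :=
  rsubmx (rsubmx (coords (a := tangent (tangent Q)) a (Gamma (param (a := tangent Q) a z)))).

Lemma sode_base w : (Gamma w).1 = w.
Proof. exact: Gamma_sode.1.2. Qed.

(** The condition on second-order fields is stated in the chart chosen at each
   point, where it says that the first half of the vector is the velocity. It
   holds in every chart because the change of coordinates on the tangent bundle
   covers that of the base, so that first halves transform like velocities. *)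
Lemma sode_coords (a : chart Q) (w : tangent Q) : dom a w.1 ->
  coords (a := tangent (tangent Q)) a (Gamma w) =
  row_mx (coords (a := tangent Q) a w) (second_order (sode_force a) (coords (a := tangent Q) a w)).
Proof.
move=> aw; set p := coords (a := tangent Q) a w.
have aw' : dom (a := tangent Q) a (Gamma w).1 by rewrite sode_base.
rewrite -[LHS]hsubmxK; congr row_mx.
  by rewrite (@tangent_coords_fst _ (tangent Q)) sode_base.
rewrite /second_order -[LHS]hsubmxK; congr row_mx; last first.
  by rewrite /sode_force /p tangent_coordK.
rewrite (@tangent_coords_snd _ (tangent Q)) sode_base.
set c : chart Q := chart_at w; set q := coords (a := tangent Q) c w.
set xi := (Gamma w).2.
have cw : dom c w.1 by exact: atlas_chart_atP.
have lq : lsubmx q = coords c w.1 by rewrite tangent_coords_fst.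
have cq : (coords c @` dom c) (lsubmx q) by rewrite lq; exists w.1.
have oc := open_lsubmx (m := dimension Q) (open_coords Qok (a := c)).
have dls (y : 'rV[R]_(dimension Q + dimension Q)) v :
    'd (lsubmx : 'rV[R]_(dimension Q + dimension Q) -> 'rV[R]_(dimension Q)) y v = lsubmx v.
  by rewrite (diff_lin (f := lsubmx)) //; exact: continuous_lsubmx.
have lxi : lsubmx xi = w.2.
  have := congr1 snd (Gamma_sode.2 w); rewrite /tangent_map /= sode_base => E.
  rewrite -[RHS]E -/c -/q -/xi -[LHS](dls q).
  have [||_ E2] := @diff_ext _ _ _ _ (lsubmx : 'rV[R]_(dimension Q + dimension Q) -> 'rV[R]_(dimension Q))
     (coords c \o @tau R Q \o param (a := tangent Q) c) q oc _ cq.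
  - by move=> y /set_mem/= /(coords_param Qok)[].
  - exact: differentiable_lsubmx.
  exact: (esym (congr1 (fun h => h xi) E2)).
have acq : (coords c @` (dom c `&` dom a)) (lsubmx q) by rewrite lq; exists w.1.
have dtr := trans_diff Qok acq.
have dT : differentiable (coords (a := tangent Q) a \o param (a := tangent Q) c) q.
  by apply: (@trans_diff _ _ TQok c a); rewrite tangent_overlapE.
have dl : lsubmx ('d (coords (a := tangent Q) a \o param (a := tangent Q) c) q xi)
    = 'd (lsubmx \o (coords (a := tangent Q) a \o param (a := tangent Q) c)) q xi.
  have E := diff_comp dT (differentiable_lsubmx _).
  by apply: esym; apply: etrans (congr1 (fun h => h xi) E) _; rewrite /= dls.
apply: etrans dl _.
have C1 := differentiable_comp (differentiable_lsubmx q) dtr.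
have [||_ E2] := @diff_ext _ _ _ _ ((coords a \o param c) \o (lsubmx : 'rV[R]_(dimension Q + dimension Q) -> 'rV[R]_(dimension Q)))
   (lsubmx \o (coords (a := tangent Q) a \o param (a := tangent Q) c)) q oc _ cq.
- by move=> y _ /=; rewrite row_mxKl.
- exact: C1.
apply: etrans (congr1 (fun h => h xi) E2) _.
apply: etrans (congr1 (fun h => h xi) (diff_comp (differentiable_lsubmx q) dtr)) _.
by rewrite /= dls lxi /p tangent_coords_snd -/c lq.
Qed.

Lemma sode_force_smooth (a : chart Q) :
  smooth_on ((lsubmx : 'rV[R]_(dimension Q + dimension Q) -> 'rV[R]_(dimension Q)) @^-1` (coords a @` dom a))
    (sode_force a).
Proof.
move=> k; have oc := open_lsubmx (m := dimension Q) (open_coords Qok (a := a)).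
have C1 : class_C k ((lsubmx : 'rV[R]_(dimension Q + dimension Q) -> 'rV[R]_(dimension Q)) @^-1` (coords a @` dom a))
    (coords (a := tangent (tangent Q)) a \o Gamma \o param (a := tangent Q) a).
  apply: class_C_subset (Gamma_sode.1.1.2 a a k) => y ya.
  have [ady _] := coords_param Qok ya.
  exists (param (a := tangent Q) a y); last exact: tangent_paramK.
  by split; [split|rewrite /= sode_base].
have C2 := class_C_comp_row oc openT (fun _ _ => I) C1 (class_C_rsubmx k setT).
exact: (class_C_comp_row oc openT (fun _ _ => I) C2 (class_C_rsubmx k setT)).
Qed.

End Sode.

(** * Trajectories and uniqueness *)

Section SodeCurves.
Context {R : realType}.
Variable Q : atlas R.
Hypothesis Qok : smooth_atlas Q.
Variable Gamma : tangent Q -> tangent (tangent Q).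
Hypothesis Gamma_sode : sode Gamma.

Let TQok : smooth_atlas (tangent Q) := tangent_smooth_atlas Qok.
Local Notation n := (dimension Q).

Lemma tangent_param_in (a : chart Q) (y : 'rV[R]_(n + n)) : (coords a @` dom a) (lsubmx y) ->
  dom a (param (a := tangent Q) a y).1.
Proof. by move=> /(coords_param Qok)[]. Qed.

Lemma continuous_tangent_param (a : chart Q) (z : R -> 'rV[R]_(n + n)) (t : R) :
  (coords a @` dom a) (lsubmx (z t)) -> {for t, continuous z} ->
  {for t, continuous (param (a := tangent Q) a \o z)}.
Proof.
move=> za cz; apply: continuous_comp => //; apply: (continuous_param TQok).
by rewrite tangent_domE.
Qed.

(** The equation says that the second half of z is the derivative of the first;
   hence the curve in the tangent bundle is the velocity of its projection. *)
Lemma solution_trajectory (a : chart Q) (z : R -> 'rV[R]_(n + n)) (W J : set R) :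
  open W -> J `<=` W -> is_interval J -> (exists t u, [/\ J t, J u & t != u]) ->
  (forall t, W t -> (coords a @` dom a) (lsubmx (z t))) ->
  (forall t : R, W t -> is_derive t 1 z (second_order (sode_force Gamma a) (z t))) ->
  [/\ integral_curve Gamma J (param (a := tangent Q) a \o z),
      trajectory Gamma J (param a \o (lsubmx \o z)) &
      forall t, J t -> velocity J (param a \o (lsubmx \o z)) t = param (a := tangent Q) a (z t)].
Proof.
move=> oW JW iJ [t1 [t2 [Jt1 Jt2 t12]]] za dz.
have pJ t : J t -> ProperFilter (within J t^') by exact: within_interval_proper iJ Jt1 Jt2 t12.
pose X := second_order (sode_force Gamma a).
have oO := open_lsubmx (m := n) (open_coords Qok (a := a)).
have sX := second_order_smooth (open_coords Qok (a := a)) (@sode_force_smooth R Q Qok Gamma Gamma_sode a).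
have sz : smooth_on W z := solution_smooth oW oO sX za dz.
have cz t : W t -> {for t, continuous z} := sz 0 t.
have sl : smooth_on W (lsubmx \o z).
  by move=> k; apply: (class_C_comp_row oW openT (fun _ _ => I) (sz k)); exact: class_C_lsubmx.
have near_W t : W t -> nbhs t W by move=> Wt; exact: open_nbhs_nbhs.
pose w := param (a := tangent Q) a \o z.
have sw : smooth_curve J w.
  by apply: (smooth_curve_of_chart TQok oW JW sz) => t Wt; rewrite tangent_domE //; exact: za.
have dw (t : R) : W t -> is_derive t 1 (coords (a := tangent Q) a \o w) (X (z t)).
  move=> Wt; apply: near_eq_is_derive (dz t Wt).
  by apply: filterS (near_W t Wt) => s Ws; rewrite /= -[LHS](tangent_paramK Qok (za s Ws)).
have vw t : J t -> velocity J w t = Gamma (w t).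
  move=> Jt; have Wt := JW _ Jt.
  have aw : dom (a := tangent Q) a (w t) by exact: tangent_param_in (za t Wt).
  have E := velocity_coords TQok Jt (pJ t Jt) (fun s _ => erefl)
    (continuous_tangent_param (za t Wt) (cz t Wt)) aw (dw t Wt).
  have wz : coords (a := tangent Q) a (w t) = z t by exact: tangent_paramK (za t Wt).
  have E2 := sode_coords Qok Gamma_sode aw.
  rewrite -(@tangent_coordK _ _ TQok a (velocity J w t)) //.
  rewrite -(@tangent_coordK _ _ TQok a (Gamma (w t))); last by rewrite sode_base.
  by rewrite E E2 wz.
have ss : smooth_curve J (param a \o (lsubmx \o z)).
  exact: (smooth_curve_of_chart Qok oW JW sl).
have vs t : J t -> velocity J (param a \o (lsubmx \o z)) t = w t.
  move=> Jt; have Wt := JW _ Jt.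
  have [ady aK] := coords_param Qok (za t Wt).
  have cs : {for t, continuous (param a \o (lsubmx \o z))}.
    apply: continuous_comp; last exact: continuous_param (za t Wt).
    exact: (sl 0).
  have ds : is_derive t 1 (coords a \o (param a \o (lsubmx \o z))) (rsubmx (z t)).
    have dl : is_derive t 1 (lsubmx \o z) (rsubmx (z t)).
      by have := is_derive1_lsubmx (dz t Wt); rewrite row_mxKl.
    apply: near_eq_is_derive dl.
    by apply: filterS (near_W t Wt) => s Ws /=; have [_ ->] := coords_param Qok (za s Ws).
  have E := velocity_coords Qok Jt (pJ t Jt) (fun s _ => erefl) cs ady ds.
  rewrite -(@tangent_coordK _ _ Qok a (velocity J _ t)) // E /= aK.
  by rewrite hsubmxK.
split => //; split => //.
by apply: integral_curve_ext (conj sw vw) => s Js; rewrite vs.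
Qed.

Lemma real_induction (P : R -> Prop) (h : R) : P 0 ->
  (forall s, 0 <= s < h -> (forall t, 0 <= t <= s -> P t) ->
    exists2 e, 0 < e & forall t, s <= t < s + e -> t <= h -> P t) ->
  (forall s, 0 < s <= h -> (forall t, 0 <= t < s -> P t) -> P s) ->
  forall t, 0 <= t <= h -> P t.
Proof.
move=> P0 Pstep Plim t /andP[t0 th].
have h0 : 0 <= h by exact: le_trans th.
pose S := [set s | 0 <= s <= h /\ forall t, 0 <= t <= s -> P t].
have S0 : S 0.
  split; first by rewrite lexx.
  by move=> r /andP[r0 r0']; have -> : r = 0 by apply: le_anti; rewrite r0 r0'.
have hS : has_sup S by split; [exists 0|exists h => s [/andP[]]].
pose s := sup S.
have s0 : 0 <= s by exact: sup_upper_bound.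
have sh : s <= h by apply: sup_le_ub; [exists 0|move=> r [/andP[]]].
have below r : 0 <= r < s -> P r.
  case/andP=> r0 rs; have sr : 0 < s - r by lra.
  have [r' [_ r'P] rr'] := sup_adherent sr hS.
  by apply: r'P; rewrite r0 /=; move: rr'; rewrite -/s; lra.
have Ps : P s.
  have [s_0|sp] := eqVneq s 0; first by rewrite s_0.
  by apply: Plim below; rewrite lt_neqAle eq_sym sp s0 sh.
have upto r : 0 <= r <= s -> P r.
  by case/andP=> r0; rewrite le_eqVlt => /predU1P[->//|rs]; apply: below; rewrite r0.
have [E|sh'] := eqVneq s h; first by apply: upto; rewrite t0 E.
have s_h : s < h by rewrite lt_neqAle sh'.
have [|e e0 eP] := Pstep s _ upto; first by rewrite s0.
pose r := Num.min h (s + e / 2).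
have sr : s < r by rewrite lt_min s_h; lra.
have Sr : S r.
  split; first by rewrite (le_trans s0 (ltW sr)) ge_min lexx.
  move=> u /andP[u0 ur]; have [us|su] := leP u s; first by apply: upto; rewrite u0.
  have uh : u <= h by apply: le_trans ur _; rewrite ge_min lexx.
  have ue : u <= s + e / 2 by apply: le_trans ur _; rewrite ge_min lexx orbT.
  by apply: eP => //; apply/andP; split; lra.
by have := sup_upper_bound hS Sr; rewrite -/s leNgt sr.
Qed.

Lemma is_derive1_shift (W : normedModType R) (y : R -> W) (s t : R) d :
  is_derive (s + t) 1 y d -> is_derive t 1 (fun r => y (s + r)) d.
Proof.
move=> /is_derive1_diff[dy <-].
have ds : is_derive t 1 (fun r : R => s + r) (1 : R).
  rewrite -[X in is_derive _ _ _ X]add0r; apply: is_deriveD.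
exact: (is_derive1_comp (y := fun r => s + r) ds dy).
Qed.

(** An integral curve that starts on a solution staying in a chart cannot leave
   it: the set of times up to which they agree is open by the Gronwall estimate,
   which applies as long as both are in the chart, and closed because the tangent
   bundle is separated. *)
Lemma integral_curve_unique (a : chart Q) (z : R -> 'rV[R]_(n + n)) (z0 : 'rV[R]_(n + n))
    (J : set R) (c : R -> tangent Q) (r h : R) :
  hausdorff_space Q -> is_interval J -> J 0 -> J h -> 0 < h ->
  (forall y : 'rV[R]_(n + n), `|y - z0| <= r -> (coords a @` dom a) (lsubmx y)) ->
  (forall t, 0 <= t <= h -> `|z t - z0| < r) ->
  (forall t : R, 0 <= t <= h -> is_derive t 1 z (second_order (sode_force Gamma a) (z t))) ->
  integral_curve Gamma J c -> c 0 = param (a := tangent Q) a (z 0) ->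
  forall t, 0 <= t <= h -> c t = param (a := tangent Q) a (z t).
Proof.
move=> hQ iJ J0 Jh h0 ra zr dz [[W [c' [oW JW cc' ccont csm]]] vc] c0.
have Jt t : 0 <= t <= h -> J t by exact: iJ.
have pJ t : J t -> ProperFilter (within J t^').
  by apply: within_interval_proper iJ J0 Jh _; rewrite lt_eqF.
pose X := second_order (sode_force Gamma a).
have sX := second_order_smooth (open_coords Qok (a := a)) (@sode_force_smooth R Q Qok Gamma Gamma_sode a).
have [L L0 lipX] := smooth_lipschitz_ball sX ra.
have za t : 0 <= t <= h -> (coords a @` dom a) (lsubmx (z t)).
  by move=> th; apply: ra; exact/ltW/zr.
apply: real_induction => // s sh Ps.
  have sh' : 0 <= s <= h by case/andP: sh => -> /ltW.
  have Es : c' s = param (a := tangent Q) a (z s).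
    by rewrite cc' ?Ps //; [rewrite lexx andbT; case/andP: sh|exact: Jt].
  have oB : open [set y : 'rV[R]_(n + n) | `|y - z0| < r] := @open_norm_lt R _ z0 r.
  have oA := @open_chart R (tangent Q) a _ oB.
  have /nbhs_ballP[e /= e0 eP] : nbhs s (c' @^-1` (dom (a := tangent Q) a `&`
      coords (a := tangent Q) a @^-1` [set y | `|y - z0| < r])).
    apply: ccont; first by apply: JW; exact: Jt.
    apply: open_nbhs_nbhs; split => //; rewrite Es; split; first exact: tangent_param_in (za s sh').
    change (`|coords (a := tangent Q) a (param (a := tangent Q) a (z s)) - z0| < r).
    by rewrite (tangent_paramK Qok (za s sh')); exact: zr.
  exists e => // t /andP[st te] th.
  case/andP: sh => s0 s_h.
  have inC tau : 0 <= tau <= t - s -> [/\ 0 <= s + tau <= h, dom (a := tangent Q) a (c (s + tau)) &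
      `|coords (a := tangent Q) a (c (s + tau)) - z0| < r].
    case/andP=> tau0 taut; have sth : 0 <= s + tau <= h by apply/andP; split; lra.
    have : ball s e (s + tau) by rewrite -ball_normE /= opprD addrA subrr sub0r normrN ger0_norm //; lra.
    by move=> /eP[]; rewrite /= cc' //; exact: Jt.
  pose u tau := coords (a := tangent Q) a (c' (s + tau)) - z (s + tau).
  have u0 : u 0 = 0 by rewrite /u addr0 Es (tangent_paramK Qok (za s sh')) subrr.
  have ut : `|u (t - s)| <= gronwall_const L (t - s) * (`|u 0| + 0).
    apply: (@gronwall _ _ u (fun tau => X (coords (a := tangent Q) a (c (s + tau))) - X (z (s + tau))) L (t - s) 0 L0 (lexx 0)) => [tau taut|tau taut|].
    - have [sth ac cr] := inC tau taut; have Jst := Jt _ sth.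
      apply: is_deriveB; last exact/is_derive1_shift/dz.
      apply: (@is_derive1_shift _ (coords (a := tangent Q) a \o c')).
      have := smooth_curve_velocity TQok Jst (pJ _ Jst) (JW _ Jst) cc' (ccont _ (JW _ Jst)) (csm a) ac.
      by rewrite vc // (sode_coords Qok Gamma_sode ac) row_mxKr.
    - have [sth ac cr] := inC tau taut; rewrite addr0 /u cc'; last exact: Jt.
      by apply: lipX; [exact: ltW|exact/ltW/zr].
    - by apply/andP; split; lra.
  have sth : 0 <= t <= h by apply/andP; split; lra.
  have tts : 0 <= t - s <= t - s by apply/andP; split; lra.
  have [_ ac _] := inC _ tts; rewrite subrKC in ac.
  have E4 : coords (a := tangent Q) a (c t) = z t.
    move: ut; rewrite u0 normr0 addr0 mulr0 normr_le0 /u subrKC cc'; last exact: Jt.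
    by move=> /eqP/subr0_eq.
  exact: etrans (esym (tangent_coordK Qok ac)) (congr1 _ E4).
case/andP: sh => s0 sh; have sh' : 0 <= s <= h by rewrite (ltW s0).
have hT := tangent_hausdorff Qok hQ.
rewrite -(cc' _ (Jt _ sh')).
pose gam := param (a := tangent Q) a \o z.
have cgam : {for s, continuous gam}.
  exact: continuous_tangent_param (za s sh') (is_derive1_continuous (dz s sh')).
have c1 : c' @ at_left s --> c' s.
  by apply: cvg_at_left_filter; apply: ccont; apply: JW; exact: Jt.
have c2 : gam @ at_left s --> gam s by exact: cvg_at_left_filter.
apply: (cvg_unique hT c1).
apply: cvg_trans c2; apply: near_eq_cvg; near=> t.
have t0 : 0 < t by near: t; exact: nbhs_left_gt.
have ts : t < s by near: t; exact: nbhs_left_lt.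
have th : 0 <= t <= h by apply/andP; split; lra.
rewrite (cc' _ (Jt _ th)) /gam /= Ps //.
by apply/andP; split; lra.
Unshelve. all: by end_near. Qed.

End SodeCurves.

(** * The exponential map of a second-order field *)

Theorem theorem3p4 (R : realType) (Q : atlas R) (Q_manifold : smooth_manifold Q)
    (Gamma : tangent Q -> tangent (tangent Q)) (Gamma_sode : sode Gamma)
    (q0 : Q) :
  exists (h0 : R) (UU : set (tangent Q)) (U Ut : set Q),
    let joins (sigma : R -> Q) (q q' : Q) :=
      [/\ trajectory Gamma `[0, h0] sigma,
          (forall t : R, 0 <= t <= h0 -> Ut (sigma t)),
          sigma 0 = q, sigma h0 = q' & UU (velocity `[0, h0] sigma 0)] in
    [/\ 0 < h0, open UU & UU `<=` exp_domain Gamma h0] /\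
    [/\ open U, open Ut, U q0 & U `<=` Ut] /\
    diffeomorphism (N := product Q Q) UU (U `*` U) (exp_map Gamma h0) /\
    (forall q q' : Q, U q -> U q' ->
      exists sigma : R -> Q, joins sigma q q' /\
        forall sigma' : R -> Q, joins sigma' q q' ->
          forall t : R, 0 <= t <= h0 -> sigma' t = sigma t) /\
    (exists sigma : R -> Q, joins sigma q0 q0 /\
        UU (velocity `[0, h0] sigma 0)).
Proof.
have Qok : smooth_atlas Q by case: Q_manifold.
have hQ : hausdorff_space Q by case: Q_manifold.
have TQok := tangent_smooth_atlas Qok.
have QQok := product_smooth_atlas Qok Qok.
pose a : chart Q := chart_at q0; pose x0 := coords a q0.
have aq0 : dom a q0 by exact: atlas_chart_atP.
have ax0 : (coords a @` dom a) x0 by exists q0.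
pose n := dimension Q.
have [phi [r [rho [delta [h [c]]]]]] :=
  local_exponential (open_coords Qok (a := a)) ax0 (@sode_force_smooth R Q Qok Gamma Gamma_sode a).
set z0 : 'rV[R]_(n + n) := row_mx x0 0; cbv zeta.
move=> [[r0 h0 c0 d0 /andP[drho rhor]] [[ra phi0 phir dphi] [sphi phic phis]]].
pose B := [set p : 'rV[R]_(n + n) | `|p - z0| < rho].
have oB : open B by exact: open_norm_lt.
have Ba p : B p -> (coords a @` dom a) (lsubmx p).
  by move=> Bp; apply: ra; apply: ltW; exact: lt_le_trans Bp rhor.
(* time interval around [0, h] on which all solutions live *)
pose W := [set t : R | `|t| < 2 * h].
have oW : open W.
  have -> : W = ball (0 : R) (2 * h).
    by apply/seteqP; split => t /=; rewrite -ball_normE /= sub0r normrN.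
  exact: ball_open.
have Wh (t : R) : 0 <= t <= h -> W t.
  by case/andP=> t0 th; rewrite /W /= ger0_norm //; lra.
have Wphi t p : W t -> B p -> `|phi t p - z0| < r by move=> /ltW Wt; exact: phir.
have Wdphi (t : R) p : W t -> B p ->
    is_derive t 1 (phi ^~ p) (second_order (sode_force Gamma a) (phi t p)).
  by move=> /ltW Wt; exact: dphi.
have Wa t p : W t -> B p -> (coords a @` dom a) (lsubmx (phi t p)).
  by move=> Wt Bp; apply: ra; exact/ltW/Wphi.
pose T := `[0, h]%classic : set R.
have TP t : T t <-> 0 <= t <= h by rewrite /T /= in_itv.
have T0 : T 0 by apply/TP; rewrite lexx ltW.
have Th : T h by apply/TP; rewrite lexx ltW.
have iT : is_interval T by exact: interval_is_interval.
have iW : is_interval W.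
  move=> s t; rewrite /W /= !ltr_norml => /andP[s1 s2] /andP[t1 t2] u /andP[su ut].
  by rewrite ltr_norml; apply/andP; split; lra.
have TW : T `<=` W by move=> t /TP; exact: Wh.
pose P (y : 'rV[R]_(n + n)) : tangent Q := param (a := tangent Q) a y.
pose pos p t : Q := (param a \o (lsubmx \o phi^~ p)) t.
have curveW p : B p -> integral_curve Gamma W (P \o phi^~ p).
  move=> Bp; have [|H _ _] := solution_trajectory Qok Gamma_sode oW (@subset_refl _ W) iW _ (fun t Wt => Wa t p Wt Bp) (fun t Wt => Wdphi t p Wt Bp).
    by exists 0, h; split; [exact: TW|exact: TW|rewrite lt_eqF].
  exact: H.
have curveT p : B p -> trajectory Gamma T (pos p) /\ forall t, T t -> velocity T (pos p) t = P (phi t p).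
  move=> Bp; have [|_ H1 H2] := solution_trajectory Qok Gamma_sode oW TW iT _ (fun t Wt => Wa t p Wt Bp) (fun t Wt => Wdphi t p Wt Bp).
    by exists 0, h; split => //; rewrite lt_eqF.
  by [].
have uniq p J (cv : R -> tangent Q) : B p -> is_interval J -> J 0 -> J h ->
    integral_curve Gamma J cv -> cv 0 = P p -> forall t, T t -> cv t = P (phi t p).
  move=> Bp iJ J0 Jh icv cv0 t /TP th.
  apply: (@integral_curve_unique R Q Qok Gamma Gamma_sode a (phi ^~ p) z0 J cv r h hQ iJ J0 Jh h0 ra _ _ icv) => //.
  - by move=> s /Wh Ws; exact: Wphi.
  - by move=> s /Wh Ws; exact: Wdphi.
  - by rewrite phi0.
have flows p : B p -> flows_to Gamma h (P p) (P (phi h p)).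
  move=> Bp; exists W, (P \o phi^~ p); split; first by split => //; exact: TW.
  by split; [exact: curveW|rewrite /= phi0|].
have flowE p : B p -> flow Gamma h (P p) = P (phi h p).
  move=> Bp; have : flows_to Gamma h (P p) (flow Gamma h (P p)).
    by apply: xgetPex; exists (P (phi h p)); exact: flows.
  move=> [J [cv [[oJ iJ J0 Jh] [icv cv0 <-]]]].
  exact: (uniq p J cv Bp iJ J0 Jh icv cv0 h Th).
pose near_x0 := [set x : 'rV[R]_n | `|x - x0| < delta].
have onear : open near_x0 by exact: open_norm_lt.
(* the exponential map in charts; V is the square of the target, D its preimage *)
pose E (p : 'rV[R]_(n + n)) : 'rV[R]_(n + n) := row_mx (lsubmx p) (lsubmx (phi h p)).
have cphi p : B p -> {for p, continuous (phi h)} by exact: (sphi 0).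
pose V := [set y : 'rV[R]_(n + n) | near_x0 (lsubmx y) /\ near_x0 (rsubmx y)].
have oV : open V.
  by apply: openI; [exact: open_lsubmx|apply: open_comp => // y _; exact: rsubmx_continuous].
have sE : smooth_on B E.
  move=> k; apply: class_C_row_mx => //; first exact: class_C_lsubmx.
  exact: (class_C_comp_row oB openT (fun _ _ => I) (sphi k) (class_C_lsubmx k setT)).
pose D := B `&` E @^-1` V.
have oD : open D by apply: (open_sub_preimage oB oV); exact: (sE 0).
have DB : D `<=` B by move=> p [].
have sED : smooth_on D E by move=> k; exact: class_C_subset DB (sE k).
have Einj p p' : B p -> B p' -> E p = E p' -> p = p'.
  move=> Bp Bp' Epp; have := phic p p' Bp Bp'; rewrite -/(E p) -/(E p') Epp subrr normr0.
  by rewrite pmulr_rle0 // normr_le0 subr_eq0 => /eqP.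
have /choice[g gP] : forall y, exists p, V y -> D p /\ E p = y.
  move=> y; have [[y1 y2]|nV] := pselect (V y); last by exists 0.
  have [v [vB vE]] := phis _ _ y1 y2.
  have Ey : E (row_mx (lsubmx y) v) = y by rewrite /E row_mxKl vE hsubmxK.
  by exists (row_mx (lsubmx y) v) => _; split => //; split => //=; rewrite Ey.
have sg : smooth_on V g.
  by apply: (inverse_smooth oD oV c0 sED _ gP) => p q /DB Bp /DB Bq; exact: phic.
pose cT (w : tangent Q) : 'rV[R]_(n + n) := coords (a := tangent Q) a w.
have PK p : B p -> cT (P p) = p by move=> Bp; exact: (tangent_paramK Qok (Ba p Bp)).
have cTK w : dom a w.1 -> P (cT w) = w by move=> aw; exact: tangent_coordK.
have PD p : B p -> dom a (P p).1 by move=> Bp; have [] := coords_param Qok (Ba p Bp).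
pose UU : set (tangent Q) := dom (a := tangent Q) a `&` cT @^-1` D.
pose U : set Q := dom a `&` coords a @^-1` near_x0.
pose Ut : set Q := dom a `&` coords a @^-1` [set x | `|x - x0| < r].
have oUU : open UU by exact: open_chart.
have oU : open U by exact: open_chart.
have UUP p : D p -> UU (P p).
  by move=> Dp; split; [exact/PD/DB|rewrite /= PK //; exact: DB].
have expE w : UU w -> exp_map Gamma h w = (w.1, param a (lsubmx (phi h (cT w)))).
  move=> [aw wD]; rewrite /exp_map; congr (_, _).
  by rewrite -{1}(cTK w aw) (flowE _ (DB _ wD)).
have U_exp w : UU w -> (U `*` U) (exp_map Gamma h w).
  move=> /[dup] UUw [aw wD]; rewrite (expE w UUw).
  have [Bw [/= V1 V2]] := wD.
  have [a1 a2] := coords_param Qok (Wa h _ (TW _ Th) Bw).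
  move: V1; rewrite row_mxKl tangent_coords_fst => V1.
  by split; split => //=; rewrite a2; move: V2; rewrite row_mxKr.
have VU q q' : U q -> U q' -> V (row_mx (coords a q) (coords a q')).
  by move=> [_ Uq] [_ Uq']; split; rewrite ?row_mxKl ?row_mxKr.
pose G (qq : product Q Q) : tangent Q := P (g (row_mx (coords a qq.1) (coords a qq.2))).
have GP qq : (U `*` U) qq -> UU (G qq) /\ exp_map Gamma h (G qq) = qq.
  case: qq => q q' [/= Uq Uq']; have [Dg Eg] := gP _ (VU q q' Uq Uq').
  have UG := UUP _ Dg; split => //; rewrite (expE _ UG) /= PK; last exact: DB.
  have := congr1 lsubmx Eg; have := congr1 rsubmx Eg; rewrite /E !row_mxKl !row_mxKr => -> ->.
  by rewrite !(atlas_coordK Qok) //; [case: Uq'|case: Uq].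
(* a competitor is an integral curve from a vector of UU, hence a flow line, and
   the endpoints determine that vector *)
have joining q q' : U q -> U q' -> exists sigma : R -> Q,
    [/\ trajectory Gamma T sigma, (forall t : R, 0 <= t <= h -> Ut (sigma t)),
          sigma 0 = q, sigma h = q' & UU (velocity T sigma 0)] /\
    forall sigma' : R -> Q, [/\ trajectory Gamma T sigma', (forall t : R, 0 <= t <= h -> Ut (sigma' t)),
          sigma' 0 = q, sigma' h = q' & UU (velocity T sigma' 0)] ->
          forall t : R, 0 <= t <= h -> sigma' t = sigma t.
  move=> Uq Uq'; have [Dp Ep] := gP _ (VU q q' Uq Uq').
  set p := g _ in Dp Ep; have Bp := DB _ Dp.
  have E1 : lsubmx p = coords a q by have := congr1 lsubmx Ep; rewrite !row_mxKl.
  have E2 : lsubmx (phi h p) = coords a q' by have := congr1 rsubmx Ep; rewrite !row_mxKr.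
  have [tp vp] := curveT p Bp.
  exists (pos p); split.
    split => //.
    - move=> t /Wh Wt; have [a1 a2] := coords_param Qok (Wa t p Wt Bp).
      split => //=; rewrite a2.
      have := lsubmx_norm (phi t p - z0); have := Wphi t p Wt Bp.
      by rewrite linearB /= {2}/z0 row_mxKl; lra.
    - by rewrite /pos /= phi0 E1 (atlas_coordK Qok) //; case: Uq.
    - by rewrite /pos /= E2 (atlas_coordK Qok) //; case: Uq'.
    - by rewrite vp // phi0; exact: UUP.
  move=> s' [[ss' is'] _ s'0 s'h [aw wD]] t /TP Tt.
  set w := velocity T s' 0 in aw wD; have Bw := DB _ wD.
  have wE := uniq (cT w) T (velocity T s') Bw iT T0 Th is' (esym (cTK w aw)).
  have s'E u : T u -> s' u = param a (lsubmx (phi u (cT w))).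
    by move=> Tu; have := congr1 fst (wE u Tu).
  have wp : cT w = p.
    apply: Einj => //; rewrite Ep; congr row_mx.
      by rewrite tangent_coords_fst /= s'0.
    by rewrite -s'h s'E //; have [_ ->] := coords_param Qok (Wa h _ (TW _ Th) Bw).
  by rewrite s'E // wp.
have Uq0 : U q0 by split => //; rewrite /near_x0 /= subrr normr0.
exists h, UU, U, Ut; split.
  split => // w [aw wD]; exists (P (phi h (cT w))).
  by have := flows _ (DB _ wD); rewrite (cTK w aw).
split.
  split => //; first by apply: open_chart; exact: open_norm_lt.
  by move=> q [aq qd]; split => //; apply: lt_le_trans qd (le_trans drho rhor).
split; last first.
  split; first exact: joining.
  have [sigma [js _]] := joining q0 q0 Uq0 Uq0.
  by exists sigma; split => //; case: js.
split.
  apply: (@smooth_map_of_chart R (tangent Q) (product Q Q) UU (exp_map Gamma h) a (a, a) E) => //.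
  - by move=> w [].
  - by move=> k; apply: class_C_subset (sED k) => _ [w [_ wD] <-].
  - move=> w /[dup] UUw [aw wD]; have [[a1 _] [a2 _]] := U_exp w UUw.
    split; first by split.
    rewrite (expE w UUw) /=; congr row_mx; first by rewrite tangent_coords_fst.
    by have [_ ->] := coords_param Qok (Wa h _ (TW _ Th) (DB _ wD)).
exists G; split => //.
- apply: (@smooth_map_of_chart R (product Q Q) (tangent Q) (U `*` U) G (a, a) a g) => //.
  + have -> : (U `*` U : set (product Q Q)) =
        dom (a := product Q Q) (a, a) `&` coords (a := product Q Q) (a, a) @^-1` V.
      apply/seteqP; split => [[q q'] [[/= a1 U1] [a2 U2]]|[q q'] [[/= a1 a2] [/= V1 V2]]].
        by split; split => //=; rewrite ?row_mxKl ?row_mxKr.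
      by move: V1 V2; rewrite row_mxKl row_mxKr => V1 V2; split; split.
    exact: open_chart.
  + by move=> [q q'] [[a1 _] [a2 _]].
  + by move=> k; apply: class_C_subset (sg k) => _ [[q q'] [U1 U2] <-]; exact: VU.
  + move=> [q q'] [U1 U2]; have [Dg _] := gP _ (VU q q' U1 U2).
    split; [exact/PD/DB|exact/PK/DB].
- move=> w /[dup] UUw [aw wD]; split; first exact: U_exp.
  have [UG EG] := GP _ (U_exp w UUw); have [aG GD] := UG.
  apply: etrans (esym (cTK _ aG)) (etrans (congr1 P _) (cTK w aw)).
  apply: Einj; [exact: DB|exact: DB|].
  have e := etrans (esym (expE _ UG)) (etrans EG (expE w UUw)).
  have e1 : (G (exp_map Gamma h w)).1 = w.1 := congr1 fst e.
  have e2 := congr1 (coords a) (congr1 snd e).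
  rewrite /E; congr row_mx.
    by rewrite (tangent_coords_fst a (G _)) (tangent_coords_fst a w) e1.
  have [_ c1] := coords_param Qok (Wa h _ (TW _ Th) (DB _ GD)).
  have [_ c2] := coords_param Qok (Wa h _ (TW _ Th) (DB _ wD)).
  exact: etrans (esym c1) (etrans e2 c2).
Qed.
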